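(* Let $f_j(x)=\rho_jx+c_j$, $0<\rho_j<1$, $c_j\in\mathbb R^d$ ($1\le j\le m$) be a self-similar IFS on $\mathbb R^d$ satisfying the strong open set condition, with attractor $J$ whose convex hull has dimension $d$, and let $(\widetilde J,\widetilde g)$ be the induced dynamical system. Let $\Phi$ be the additive potential on $(\widetilde J,\widetilde g)$ associated with the identity map of $J$, and for $\alpha\in\mathbb R^d$ let $\mathcal D_\Phi(\alpha)=\dim_HE_\Phi(\alpha)$, where $E_\Phi(\alpha)=\{x\in\widetilde J:\lim_{n\to\infty}\frac1n\sum_{k=0}^{n-1}\widetilde g^kx=\alpha\}$. Let $$\mathcal F(\widetilde J,\widetilde g)=\Big\{x\in\widetilde J:\lim_{n\to\infty}\frac1n\sum_{k=0}^{n-1}\widetilde g^kx=x\Big\}.$$ Then $\mathcal F(\widetilde J,\widetilde g)$ is dense in $J$ and $\dim_H\mathcal F(\widetilde J,\widetilde g)=\sup\{\mathcal D_\Phi(\alpha):\alpha\in J\}$. Moreover, if the point at which $\mathcal D_\Phi$ attains its maximum (over $L_\Phi=\{\alpha:E_\Phi(\alpha)\ne\emptyset\}$) belongs to $J$, then $\mathcal F(\widetilde J,\widetilde g)$ is of full Hausdorff dimension in $J$, i.e. $\dim_H\mathcal F(\widetilde J,\widetilde g)=\dim_HJ$.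
   Context: The attractor $J$ is the unique nonempty compact set with $J=\bigcup_jf_j(J)$. Strong open set condition: there is a nonempty open set $W\subset\mathbb R^d$ with $f_j(W)\subset W$, $f_i(W)\cap f_j(W)=\emptyset$ for $i\ne j$, and $W\cap J\ne\emptyset$. Let $\Delta$ be the convex hull of $J$ (it equals the convex hull of the fixed points of the $f_j$) and $V:=W\cap\mathrm{int}(\Delta)$, which is again an open set for which the strong open set condition holds. Let $\Sigma_m=\{1,\dots,m\}^{\mathbb N}$ with shift $T$; $f_w=f_{w_1}\circ\cdots\circ f_{w_n}$ for a finite word $w=w_1\cdots w_n$ (identity for the empty word); $\chi:\Sigma_m\to J$, $\chi(x)$ the unique point of $\bigcap_nf_{x_1\cdots x_n}(\overline V)$; $\widetilde Z_\infty=\bigcup_wf_w(\partial V)$ (union over all finite words, including the empty one); $Z_\infty=\chi^{-1}(\widetilde Z_\infty)$; $\widetilde J=J\setminus\widetilde Z_\infty$. The map $\chi:\Sigma_m\setminus Z_\infty\to\widetilde J$ is a bijection, $T(\Sigma_m\setminus Z_\infty)\subset\Sigma_m\setminus Z_\infty$, and $\widetilde g=\chi\circ T\circ\chi^{-1}:\widetilde J\to\widetilde J$. *)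

(* Defs.v *)
From HB Require Import structures.
From mathcomp Require Import all_boot all_order all_algebra.
From mathcomp Require Import all_classical all_reals all_analysis.

Set Implicit Arguments.
Unset Strict Implicit.
Unset Printing Implicit Defensive.

Import Order.TTheory GRing.Theory Num.Theory.
Import numFieldNormedType.Exports.

Local Open Scope classical_set_scope.
Local Open Scope ring_scope.

(** * Euclidean Hausdorff measure and dimension in R^d *)

(* The norm that the library puts on ['rV[R]_d] is the sup norm; it induces the
   usual topology, but diameters are taken here for the Euclidean distance. *)
Definition edist (R : realType) (d : nat) (x y : 'rV[R]_d) : R :=
  Num.sqrt (\sum_(i < d) (x ord0 i - y ord0 i) ^+ 2).

(* Equal to -oo on the empty set. *)
Definition ediam (R : realType) (d : nat) (A : set 'rV[R]_d) : \bar R :=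
  ereal_sup [set (edist p.1 p.2)%:E | p in A `*` A].

(* diam(A)^s, with diam(set0)^s = 0, and diam(A)^0 = 1 for A nonempty. *)
Definition hausdorff_gauge (R : realType) (d : nat) (s : R)
    (A : set 'rV[R]_d) : \bar R :=
  if A == set0 then 0%E else poweR (ediam A) s.

Definition hausdorff_premeasure (R : realType) (d : nat) (s delta : R)
    (A : set 'rV[R]_d) : \bar R :=
  ereal_inf [set (\sum_(0 <= i <oo) hausdorff_gauge s (U i))%E |
    U in [set U : nat -> set 'rV[R]_d |
            A `<=` \bigcup_i U i /\ forall i, (ediam (U i) <= delta%:E)%E]].

Definition hausdorff_measure (R : realType) (d : nat) (s : R)
    (A : set 'rV[R]_d) : \bar R :=
  ereal_sup [set hausdorff_premeasure s delta A | delta in [set r : R | 0 < r]].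

(* With this convention the empty set has dimension 0. *)
Definition hausdorff_dim (R : realType) (d : nat) (A : set 'rV[R]_d) : \bar R :=
  ereal_inf [set s%:E | s in [set s : R | 0 <= s /\ hausdorff_measure s A = 0%E]].

(** * Convex hulls and their dimension *)

Definition convex_hull (R : realType) (d : nat) (A : set 'rV[R]_d) :
    set 'rV[R]_d :=
  \bigcap_(C in [set C : set 'rV[R]_d | convex_set C /\ A `<=` C]) C.

(* The dimension of a nonempty set is that of its affine hull, i.e. of the
   linear span of A - x0 for any x0 in A. *)
Definition has_affine_dim (R : realType) (d : nat) (A : set 'rV[R]_d)
    (k : nat) : Prop :=
  exists x0 : 'rV[R]_d, A x0 /\
  exists U : {vspace 'rV[R]_d},
    [/\ forall x, A x -> x - x0 \in U,
        forall U' : {vspace 'rV[R]_d},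
          (forall x, A x -> x - x0 \in U') -> (U <= U')%VS
      & \dim U = k].

Definition boundary (T : topologicalType) (A : set T) : set T :=
  closure A `\` interior A.

(** * Self-similar iterated function systems *)

Definition ifs (R : realType) (d m : nat) (rho : 'I_m -> R)
    (c : 'I_m -> 'rV[R]_d) (j : 'I_m) (x : 'rV[R]_d) : 'rV[R]_d :=
  rho j *: x + c j.

Definition is_attractor (R : realType) (d m : nat)
    (f : 'I_m -> 'rV[R]_d -> 'rV[R]_d) (J : set 'rV[R]_d) : Prop :=
  [/\ J !=set0, compact J & J = \bigcup_(j in [set: 'I_m]) (f j @` J)].

(* The strong open set condition, witnessed by W. *)
Definition sosc (R : realType) (d m : nat)
    (f : 'I_m -> 'rV[R]_d -> 'rV[R]_d) (J W : set 'rV[R]_d) : Prop :=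
  [/\ open W, W !=set0, forall j, f j @` W `<=` W,
      forall i j, i != j -> (f i @` W) `&` (f j @` W) = set0
    & W `&` J !=set0].

(** * Symbolic coding and the induced dynamical system *)

(* Words are 0-indexed: letter [x i] is the (i+1)-st one. *)
Definition word_map (T : Type) (m : nat) (f : 'I_m -> T -> T) (w : seq 'I_m)
    (x : T) : T :=
  foldr f x w.

Definition shift (m : nat) (x : nat -> 'I_m) : nat -> 'I_m := fun n => x n.+1.

(* [get] selects the point of the intersection, which is a singleton under the
   strong open set condition for a bounded V. *)
Definition coding (R : realType) (d m : nat)
    (f : 'I_m -> 'rV[R]_d -> 'rV[R]_d) (V : set 'rV[R]_d)
    (x : nat -> 'I_m) : 'rV[R]_d :=
  get (\bigcap_n (word_map f (mkseq x n) @` closure V)).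

Definition bad_points (R : realType) (d m : nat)
    (f : 'I_m -> 'rV[R]_d -> 'rV[R]_d) (V : set 'rV[R]_d) : set 'rV[R]_d :=
  \bigcup_(w in [set: seq 'I_m]) (word_map f w @` boundary V).

Definition bad_words (R : realType) (d m : nat)
    (f : 'I_m -> 'rV[R]_d -> 'rV[R]_d) (V : set 'rV[R]_d) :
    set (nat -> 'I_m) :=
  coding f V @^-1` bad_points f V.

Definition regular_attractor (R : realType) (d m : nat)
    (f : 'I_m -> 'rV[R]_d -> 'rV[R]_d) (V J : set 'rV[R]_d) : set 'rV[R]_d :=
  J `\` bad_points f V.

(* chi \o T \o chi^-1, where chi^-1 is the inverse of the restriction of chi to
   the complement of [bad_words]: the set under [get] is a singleton for x in
   the regular attractor; values elsewhere are irrelevant. *)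
Definition induced_map (R : realType) (d m : nat)
    (f : 'I_m -> 'rV[R]_d -> 'rV[R]_d) (V : set 'rV[R]_d)
    (x : 'rV[R]_d) : 'rV[R]_d :=
  get [set coding f V (shift y) |
        y in ~` bad_words f V `&` coding f V @^-1` [set x]].

(** * Additive potentials and Birkhoff averages *)

Definition additive_potential (T : Type) (V : zmodType) (g : T -> T)
    (phi : T -> V) (n : nat) (x : T) : V :=
  \sum_(0 <= k < n) phi (iter k g x).

Definition level_set (R : realType) (d : nat) (X : set 'rV[R]_d)
    (Phi : nat -> 'rV[R]_d -> 'rV[R]_d) (alpha : 'rV[R]_d) : set 'rV[R]_d :=
  [set x | X x /\ (n%:R^-1 : R) *: Phi n x @[n --> \oo] --> alpha].

Definition fixed_average_set (R : realType) (d : nat) (X : set 'rV[R]_d)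
    (g : 'rV[R]_d -> 'rV[R]_d) : set 'rV[R]_d :=
  [set x | X x /\
     (n%:R^-1 : R) *: (\sum_(0 <= k < n) iter k g x) @[n --> \oo] --> x].

(* Main.v *)
Require Import Defs.
From HB Require Import structures.
From mathcomp Require Import all_boot all_order all_algebra.
From mathcomp Require Import all_classical all_reals all_analysis.
From mathcomp Require Import ring lra.

Set Implicit Arguments.
Unset Strict Implicit.
Unset Printing Implicit Defensive.

Import Order.TTheory GRing.Theory Num.Theory.
Import numFieldNormedType.Exports.

Local Open Scope classical_set_scope.
Local Open Scope ring_scope.

(* For a finite word w let B(w) be the sum of f_u(x0) over the nonempty suffixes
   u of w. Up to a bounded error, B is additive under concatenation and B of the
   first n letters of y is the n-th orbit sum of chi(y). Say that p is s-rich if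
   for every delta there are infinitely many n such that the words w of length n
   with |B(w)/n - p| <= delta satisfy sum rho_w^s >= 1.

   Covering by cylinders shows that p is s-rich whenever dim E(p) > s, and, with
   compactness of J, that dim F <= s if no point of J is s-rich. In the same way
   some point of the hull is s-rich for each s < dim J.

   Conversely, let p be s-rich and let q be close to p, slightly inside the hull.
   Concatenate blocks w j^l w0, where w runs over a set of words witnessing that
   p is rich and the letter j is chosen, according to the discrepancy accumulated
   so far, to push it towards 0; this keeps all orbit sums at bounded distance
   from n times the target. The target may be q itself, or the limit point under
   construction, which is known better and better. As l is a small proportion of
   the length of w, the Moran set obtained has dimension close to s, and the fixed
   word w0, whose cylinder lies in V, makes its points regular. Targets of both
   kinds near a point p of J are available inside J: if chi(z) = p, a point
   f_{z_1...z_N}(x) of J with x interior lies on the inner side of every face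
   that contains p. *)

Local Notation edist := Defs.edist.

(** * Norms and the dot product of row vectors *)

Section RowVectors.
Variables (R : realType) (d : nat).
Implicit Types x y u v S : 'rV[R]_d.

Lemma coord_le_norm x i : `|x ord0 i| <= `|x|.
Proof.
rewrite /Num.norm/= mx_normrE.
exact: (le_bigmax _ (fun ij : 'I_1 * 'I_d => `|x ij.1 ij.2|) (ord0, i)).
Qed.

Lemma norm_le_coord x e : 0 <= e -> (forall i, `|x ord0 i| <= e) -> `|x| <= e.
Proof.
move=> e0 h; rewrite /Num.norm/= mx_normrE.
by apply: bigmax_le => // -[i j] _ /=; rewrite ord1.
Qed.

Lemma norm_le_edist x y : `|x - y| <= edist x y.
Proof.
apply: norm_le_coord => [|i]; first exact: sqrtr_ge0.
rewrite !mxE /edist -sqrtr_sqr; apply: ler_wsqrtr.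
rewrite (bigD1 i)//= lerDl; apply: sumr_ge0 => j _; exact: sqr_ge0.
Qed.

(** The crude factor [d], in place of its square root, is enough: diameters matter only up to a
    constant. *)
Lemma edist_le_norm x y : edist x y <= d%:R * `|x - y|.
Proof.
rewrite /edist -(ger0_norm (_ : 0 <= d%:R * `|x - y|)); last by rewrite mulr_ge0.
rewrite -sqrtr_sqr; apply: ler_wsqrtr.
apply: (@le_trans _ _ (\sum_(i < d) `|x - y| ^+ 2)).
  apply: ler_sum => i _; rewrite -real_normK ?num_real//.
  rewrite lerXn2r ?nnegrE//.
  by have := coord_le_norm (x - y) i; rewrite !mxE.
rewrite sumr_const card_ord -[leLHS]mulr_natl exprMn ler_wpM2r ?sqr_ge0//.
case: d => [|n]; first by rewrite expr0n.
by rewrite ler_eXnr// ler1n.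
Qed.

Lemma edist_scale (r : R) c x y : 0 <= r ->
  edist (r *: x + c) (r *: y + c) = r * edist x y.
Proof.
move=> r0; rewrite /edist -[in RHS](ger0_norm r0) -sqrtr_sqr -sqrtrM ?sqr_ge0//.
congr Num.sqrt; rewrite mulr_sumr; apply: eq_bigr => i _; rewrite !mxE; ring.
Qed.

Definition dot u v : R := \sum_(i < d) u ord0 i * v ord0 i.
(** The l^1 norm is dual to the sup norm [|_|]; by [dot_sgr] and [norm_sgr] the sign vector attains
    this duality. *)
Definition norm1 u : R := \sum_(i < d) `|u ord0 i|.

Lemma dotDr S u v : dot S (u + v) = dot S u + dot S v.
Proof. by rewrite /dot -big_split; apply: eq_bigr => i _; rewrite mxE mulrDr. Qed.

Lemma dotZr S a u : dot S (a *: u) = a * dot S u.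
Proof. by rewrite /dot mulr_sumr; apply: eq_bigr => i _; rewrite mxE; ring. Qed.

Lemma dotNr S u : dot S (- u) = - dot S u.
Proof. by rewrite -scaleN1r dotZr mulN1r. Qed.

Lemma dotBr S u v : dot S (u - v) = dot S u - dot S v.
Proof. by rewrite dotDr dotNr. Qed.

Lemma dotC u v : dot u v = dot v u.
Proof. by apply: eq_bigr => i _; rewrite mulrC. Qed.

Lemma norm1_ge0 S : 0 <= norm1 S.
Proof. exact: sumr_ge0. Qed.

Lemma dot_le S u : `|dot S u| <= norm1 S * `|u|.
Proof.
apply: le_trans (ler_norm_sum _ _ _) _; rewrite /norm1 mulr_suml.
by apply: ler_sum => i _; rewrite normrM ler_wpM2l// coord_le_norm.
Qed.

Lemma dot_le_norm1 S u : dot S u <= norm1 S * `|u|.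
Proof. exact: le_trans (ler_norm _) (dot_le _ _). Qed.

Lemma dot_ge_norm1 S u : - (norm1 S * `|u|) <= dot S u.
Proof. by have := dot_le S u; rewrite ler_norml => /andP[]. Qed.

Lemma dot_sgr S : dot S (\row_i Num.sg (S ord0 i)) = norm1 S.
Proof. by apply: eq_bigr => i _; rewrite mxE mulrC -normrEsg. Qed.

Lemma norm_sgr S : `|\row_i Num.sg (S ord0 i) : 'rV[R]_d| <= 1.
Proof.
by apply: norm_le_coord => // i; rewrite mxE normr_sg; case: (S ord0 i != 0).
Qed.

Lemma norm1_le S : norm1 S <= d%:R * `|S|.
Proof.
apply: (@le_trans _ _ (\sum_(i < d) `|S|)).
  by apply: ler_sum => i _; exact: coord_le_norm.
by rewrite sumr_const card_ord mulr_natl.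
Qed.

Lemma dot_self_le S : dot S S <= norm1 S ^+ 2.
Proof.
apply: le_trans (dot_le_norm1 _ _) _; rewrite expr2 ler_wpM2l ?norm1_ge0//.
apply: norm_le_coord => [|i]; first exact: norm1_ge0.
by rewrite /norm1 (bigD1 i)//= lerDl sumr_ge0.
Qed.

Lemma norm_le_dot S (M : R) : 0 <= M -> dot S S <= M ^+ 2 -> `|S| <= M.
Proof.
move=> M0 h; apply: norm_le_coord => // i.
rewrite -(ler_pXn2r (n:=2))// ?nnegrE// real_normK ?num_real//.
apply: le_trans h; rewrite /dot (bigD1 i)//= -expr2 lerDl.
by apply: sumr_ge0 => j _; rewrite -expr2 sqr_ge0.
Qed.

End RowVectors.

(** * Words and the contractions they induce *)

Section Words.
Variable T : Type.
Implicit Types y : nat -> T.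

Definition shiftn (a : nat) y : nat -> T := fun i => y (a + i)%N.

Lemma shiftn0 y : shiftn 0 y = y.
Proof. by apply/funext => i. Qed.

Lemma shiftnD a b y : shiftn a (shiftn b y) = shiftn (b + a) y.
Proof. by apply/funext => i; rewrite /shiftn addnA. Qed.

Lemma mkseq_shiftn y a b : mkseq y (a + b) = mkseq y a ++ mkseq (shiftn a y) b.
Proof.
rewrite /mkseq iotaD map_cat; congr (_ ++ _).
by rewrite add0n -[X in iota X](addn0 a) iotaDl -map_comp.
Qed.

Lemma mkseq_cons y n : mkseq y n.+1 = y 0%N :: mkseq (shiftn 1 y) n.
Proof. by rewrite -addn1 addnC mkseq_shiftn. Qed.

End Words.

Section Ifs.
Variables (R : realType) (d m : nat) (rho : 'I_m -> R) (c : 'I_m -> 'rV[R]_d).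
Hypothesis hrho : forall j, 0 < rho j < 1.
Local Notation fw := (word_map (ifs rho c)).
Implicit Types (w u v : seq 'I_m) (x y : nat -> 'I_m) (p q : 'rV[R]_d).

Definition ratio (w : seq 'I_m) : R := \prod_(j <- w) rho j.
(** The default 2^-1 keeps [rmax] and [rmin] strictly between 0 and 1 even over an empty
    alphabet. *)
Definition rmax : R := \big[Order.max/2^-1]_j rho j.
Definition rmin : R := \big[Order.min/2^-1]_j rho j.

Lemma rmax_ge j : rho j <= rmax.
Proof. exact: le_bigmax. Qed.

Lemma rmin_le j : rmin <= rho j.
Proof. exact: bigmin_le. Qed.

Lemma rmax01 : 0 < rmax < 1.
Proof.
apply/andP; split; last first.
  apply: bigmax_lt => [|j _]; first lra.
  by case/andP: (hrho j).
by apply: (@lt_le_trans _ _ (2^-1)); [lra|exact: bigmax_ge_id].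
Qed.

Lemma rmin01 : 0 < rmin < 1.
Proof.
apply/andP; split.
  apply: lt_bigmin => [|j _]; first lra.
  by case/andP: (hrho j).
by apply: (@le_lt_trans _ _ (2^-1)); [exact: bigmin_le_id|lra].
Qed.

Lemma ratio_nil : ratio [::] = 1. Proof. by rewrite /ratio big_nil. Qed.
Lemma ratio_cons j w : ratio (j :: w) = rho j * ratio w.
Proof. by rewrite /ratio big_cons. Qed.
Lemma ratio_cat u v : ratio (u ++ v) = ratio u * ratio v.
Proof. by rewrite /ratio big_cat. Qed.

Lemma ratio_gt0 w : 0 < ratio w.
Proof. by apply: prodr_gt0 => j _; case/andP: (hrho j). Qed.

Lemma ratio_le w : ratio w <= rmax ^+ size w.
Proof.
elim: w => [|j w IH]; first by rewrite ratio_nil.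
rewrite ratio_cons exprS ler_pM ?rmax_ge ?(ltW (ratio_gt0 _))// ltW//.
by case/andP: (hrho j).
Qed.

Lemma ratio_ge w : rmin ^+ size w <= ratio w.
Proof.
have [r0 r1] := andP rmin01.
elim: w => [|j w IH]; first by rewrite ratio_nil.
by rewrite ratio_cons exprS ler_pM ?rmin_le ?exprn_ge0 ?(ltW r0).
Qed.

Lemma fwE w p : fw w p = ratio w *: p + fw w 0.
Proof.
elim: w => [|j w IH] /=; first by rewrite ratio_nil scale1r addr0.
by rewrite /ifs IH ratio_cons scalerDr scalerA addrA.
Qed.

Lemma fwB w p q : fw w p - fw w q = ratio w *: (p - q).
Proof. by rewrite fwE (fwE w q) opprD addrACA subrr addr0 scalerBr. Qed.

Lemma fw_cat u v p : fw (u ++ v) p = fw u (fw v p).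
Proof. exact: foldr_cat. Qed.

Lemma fw_inj w : injective (fw w).
Proof.
move=> p q /eqP; rewrite -subr_eq0 fwB scaler_eq0 (gt_eqF (ratio_gt0 w))/=.
by rewrite subr_eq0 => /eqP.
Qed.

Lemma fw_continuous w : continuous (fw w).
Proof.
move=> p; rewrite (_ : fw w = fun q => ratio w *: q + fw w 0); last first.
  by apply/funext => q; rewrite -fwE.
apply: continuousD; last exact: cst_continuous.
exact: scaler_continuous.
Qed.

Definition fwV (w : seq 'I_m) (p : 'rV[R]_d) := (ratio w)^-1 *: (p - fw w 0).

Lemma fwVK w p : fw w (fwV w p) = p.
Proof.
rewrite fwE /fwV scalerA divff ?gt_eqF ?ratio_gt0// scale1r subrK//.
Qed.

Lemma fwKV w p : fwV w (fw w p) = p.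
Proof. by apply: (@fw_inj w); rewrite fwVK. Qed.

Lemma fwV_continuous w : continuous (fwV w).
Proof.
move=> p; rewrite (_ : fwV w = fun q => (ratio w)^-1 *: q - (ratio w)^-1 *: fw w 0).
  by apply: continuousB; [exact: scaler_continuous|exact: cst_continuous].
by apply/funext => q; rewrite /fwV scalerBr.
Qed.

Lemma fw_image_open w (A : set 'rV[R]_d) : open A -> open (fw w @` A).
Proof.
move=> oA; rewrite (_ : _ @` _ = fwV w @^-1` A); last first.
  apply/seteqP; split => p /=; first by move=> [q Aq <-]; rewrite fwKV.
  by move=> Ap; exists (fwV w p) => //; rewrite fwVK.
by apply: open_comp => // p _; exact: fwV_continuous.
Qed.

End Ifs.

(** * The coding map *)

Lemma expr_small (R : realType) (r C e : R) : 0 <= r < 1 -> 0 < e ->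
  exists n, forall k, (n <= k)%N -> r ^+ k * C < e.
Proof.
move=> /andP[r0 r1] e0.
have /cvgrPdist_lt h : (r ^+ n) @[n --> \oo] --> (0 : R).
  by apply: cvg_expr; rewrite ger0_norm.
have C0 : 0 < `|C| + 1 by rewrite ltr_wpDl.
have [n _ hn] := h _ (divr_gt0 e0 C0).
exists n => k nk; have := hn k nk.
rewrite sub0r normrN ger0_norm ?exprn_ge0// ltr_pdivlMr// => hk.
apply: le_lt_trans hk; rewrite ler_wpM2l ?exprn_ge0//.
by rewrite (le_trans (ler_norm C))// lerDl.
Qed.

Section Coding.
Variables (R : realType) (d m : nat) (rho : 'I_m -> R) (c : 'I_m -> 'rV[R]_d).
Variables (J V : set 'rV[R]_d) (M : R).
Hypothesis hrho : forall j, 0 < rho j < 1.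
Hypothesis hJ : is_attractor (ifs rho c) J.
Hypothesis hV : sosc (ifs rho c) J V.
Hypothesis bV : forall p, V p -> `|p| <= M.
Local Notation f := (ifs rho c).
Local Notation fw := (word_map (ifs rho c)).
Local Notation rmax := (rmax rho).
Local Notation chi := (coding (ifs rho c) V).
Implicit Types (w u v : seq 'I_m) (x y : nat -> 'I_m) (p q : 'rV[R]_d).

Lemma fw_attractor w p : J p -> J (fw w p).
Proof.
move=> Jp; elim: w => [//|j w IH] /=.
by case: hJ => _ _ ->; exists j => //; exists (fw w p).
Qed.

Lemma fw_sub_open w p : V p -> V (fw w p).
Proof.
move=> Vp; elim: w => [//|j w IH] /=.
by case: hV => _ _ h _ _; apply: (h j); exists (fw w p).
Qed.

(** Equal leading letters cancel by injectivity; where the words first differ, the images of [V] are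
    disjoint. *)
Lemma fw_disjoint u v p q : size u = size v -> V p -> V q -> fw u p = fw v q -> u = v.
Proof.
elim: u v => [|i u IH] [|j v]//= [suv] Vp Vq e.
case: (eqVneq i j) => [ij|ij].
  subst j; congr (_ :: _); apply: IH => //.
  exact: (@fw_inj _ _ _ _ c hrho [:: i]).
case: hV => _ _ _ /(_ i j ij) h _.
suff : (f i @` V `&` f j @` V) (f i (fw u p)) by rewrite h.
split; first by exists (fw u p) => //; exact: fw_sub_open.
by rewrite e; exists (fw v q) => //; exact: fw_sub_open.
Qed.

Lemma fw_contract w p q (C : R) : `|p| <= C -> `|q| <= C ->
  `|fw w p - fw w q| <= rmax ^+ size w * (2 * C).
Proof.
move=> hp hq; rewrite fwB normrZ gtr0_norm ?ratio_gt0// ler_pM ?ratio_le ?(ltW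
  (ratio_gt0 _ _))//.
by rewrite (le_trans (ler_normB _ _))// mulr_natl mulr2n lerD.
Qed.

Lemma contract_eq p q (C : R) : (forall n, `|p - q| <= rmax ^+ n * C) -> p = q.
Proof.
move=> h; apply/eqP; rewrite -subr_eq0 -normr_eq0; apply/negPn/negP => h0.
have {}h0 : 0 < `|p - q| by rewrite lt_neqAle eq_sym h0 normr_ge0.
have r01 : 0 <= rmax < 1 by have /andP[/ltW -> ->] := rmax01 hrho.
have [n /(_ n (leqnn n))] := expr_small C r01 h0.
by rewrite ltNge h.
Qed.

(** For each point of [J] a letter and a preimage in [J] are chosen; the letters met along the
    iterated choice form the code. *)
Lemma attractor_code p : J p ->
  exists y, forall n, exists2 q, J q & p = fw (mkseq y n) q.
Proof.
move=> Jp.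
have [j0] : exists j0 : 'I_m, True.
  by move: Jp; case: hJ => _ _ -> [j _ _]; exists j.
move=> _.
have : forall q, exists jq : 'I_m * 'rV[R]_d, J q -> J jq.2 /\ q = f jq.1 jq.2.
  move=> q; have [Jq|nJq] := pselect (J q); last by exists (j0, q).
  move: (Jq); case: hJ => _ _ {1}-> [j _ [q' Jq' <-]].
  by exists (j, q').
move=> /choice [g hg].
pose st n := iter n (fun q => (g q).2) p.
have Jst n : J (st n) by elim: n => [//|n IH]; have [] := hg _ IH.
exists (fun n => (g (st n)).1); elim => [|n [q Jq pE]]; first by exists p.
exists (st n.+1) => //.
suff -> : p = fw (mkseq (fun n => (g (st n)).1) n) (st n).
  rewrite mkseqS -cats1 fw_cat; apply: (congr1 (fw _)).
  exact: (hg _ (Jst n)).2.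
elim: n {q Jq pE} => [//|n IH].
rewrite mkseqS -cats1 fw_cat {1}IH; apply: (congr1 (fw _)).
exact: (hg _ (Jst n)).2.
Qed.

(** A common point of [V] and [J], pushed into the n-th cylinder around [p], stays in [V] and tends
    to [p]. *)
Lemma attractor_sub_closure p : J p -> closure V p.
Proof.
move=> Jp; have [v [Vv Jv]] : V `&` J !=set0 by case: hV.
have [_ cJ _] := hJ.
have [C [_ hC]] := compact_bounded cJ.
have bJ q : J q -> `|q| <= C + 1 by apply: hC; rewrite ltrDl.
have [y hy] := attractor_code Jp.
move=> B /nbhs_ballP[e /= e0 eB].
have r01 : 0 <= rmax < 1 by have /andP[/ltW -> ->] := rmax01 hrho.
have [n hn] := expr_small (2 * (C + 1)) r01 e0.
have [q Jq pE] := hy n.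
exists (fw (mkseq y n) v); split; first exact: fw_sub_open.
apply: eB; rewrite -ball_normE /= pE.
apply: le_lt_trans (fw_contract _ (bJ _ Jq) (bJ _ Jv)) _.
by rewrite size_mkseq; exact: hn.
Qed.

Lemma closure_bound p : closure V p -> `|p| <= M.
Proof.
move=> cp; apply/ler_addgt0Pr => e e0.
have [q [Vq]] := cp _ (nbhsx_ballx p e e0).
rewrite -ball_normE /= => /ltW h.
by rewrite -(subrK q p) addrC (le_trans (ler_normD _ _))// lerD// bV.
Qed.

Lemma attractor_bound p : J p -> `|p| <= M.
Proof. by move=> /attractor_sub_closure/closure_bound. Qed.

(** By compactness the points [fw (mkseq y n) x0] cluster in [J]; each cylinder is closed and
    contains all but finitely many of them, hence also the cluster point. *)
Lemma code_point y : exists p, forall n, exists2 q, J q & p = fw (mkseq y n) q.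
Proof.
have [[x0 Jx0] cJ _] := hJ.
pose F := (fw (mkseq y n) x0) @[n --> \oo].
have FJ : F J by exists 0%N => // n _; exact: fw_attractor.
have [p [Jp clp]] := cJ F _ FJ.
exists p => n.
have : closed (fw (mkseq y n) @` J).
  apply: compact_closed; first exact: norm_hausdorff.
  apply: continuous_compact => //; apply: continuous_subspaceT.
  exact: fw_continuous.
move=> /closure_id h; suff : (fw (mkseq y n) @` J) p by case=> q Jq <-; exists q.
rewrite h => B nB; apply: clp => //.
exists n => //= k /= nk; exists (fw (mkseq (shiftn n y) (k - n)) x0).
  exact: fw_attractor.
by rewrite -fw_cat -mkseq_shiftn subnKC.
Qed.

(** Contraction leaves at most one point with bounded preimages, and [code_point] shows that [get]
    in [coding] selects from a nonempty set. Later identities for [chi] are all checked through this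
    criterion. *)
Lemma coding_uniq y p :
  (forall n, exists2 q, `|q| <= M & p = fw (mkseq y n) q) -> p = chi y.
Proof.
move=> hp; have [p' hp'] := code_point y.
have E q : (forall n, exists2 q', `|q'| <= M & q = fw (mkseq y n) q') -> q = p.
  move=> hq; apply: (@contract_eq _ _ (2 * M)) => n.
  have [a ha ->] := hq n; have [b hb ->] := hp n.
  by have := fw_contract (mkseq y n) ha hb; rewrite size_mkseq.
have p'c : (\bigcap_n (fw (mkseq y n) @` closure V)) p'.
  move=> n _; have [q Jq ->] := hp' n; exists q => //.
  exact: attractor_sub_closure.
apply/esym/E => n.
have := @getPex _ (\bigcap_n (fw (mkseq y n) @` closure V)) (ex_intro _ _ p'c).
move=> /(_ n Logic.I) [q cq e]; exists q; first exact: closure_bound.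
by rewrite e.
Qed.

Lemma codingP y n : exists2 q, J q & chi y = fw (mkseq y n) q.
Proof.
have [p hp] := code_point y.
suff <- : p = chi y by exact: hp.
apply: coding_uniq => k; have [q Jq ->] := hp k; exists q => //.
exact: attractor_bound.
Qed.

Lemma coding_attractor y : J (chi y).
Proof. by have [q Jq ->] := codingP y 0. Qed.

Lemma coding_shift y n : chi y = fw (mkseq y n) (chi (shiftn n y)).
Proof.
apply/esym/coding_uniq => k.
have [kn|nk] := leqP k n.
  exists (fw (mkseq (shiftn k y) (n - k)) (chi (shiftn n y))).
    by apply: attractor_bound; apply: fw_attractor; exact: coding_attractor.
  by rewrite -fw_cat -mkseq_shiftn subnKC.
have [q Jq ->] := codingP (shiftn n y) (k - n).
exists q; first exact: attractor_bound.
by rewrite -fw_cat -mkseq_shiftn subnKC// ltnW.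
Qed.

Lemma coding_surj p : J p -> exists y, p = chi y.
Proof.
move=> Jp; have [y hy] := attractor_code Jp; exists y.
apply: coding_uniq => n; have [q Jq ->] := hy n; exists q => //.
exact: attractor_bound.
Qed.

Lemma coding_agree x y n : mkseq x n = mkseq y n ->
  `|chi x - chi y| <= rmax ^+ n * (2 * M).
Proof.
move=> e; rewrite (coding_shift x n) (coding_shift y n) e.
have := fw_contract (mkseq y n) (attractor_bound (coding_attractor (shiftn n x)))
  (attractor_bound (coding_attractor (shiftn n y))).
by rewrite size_mkseq.
Qed.

End Coding.

(** * Regular points and orbit sums *)

Section Regular.
Variables (R : realType) (d m : nat) (rho : 'I_m -> R) (c : 'I_m -> 'rV[R]_d).
Variables (J V : set 'rV[R]_d) (M : R).
Hypothesis hrho : forall j, 0 < rho j < 1.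
Hypothesis hJ : is_attractor (ifs rho c) J.
Hypothesis hV : sosc (ifs rho c) J V.
Hypothesis bV : forall p, V p -> `|p| <= M.
Local Notation fw := (word_map (ifs rho c)).
Local Notation rmax := (rmax rho).
Local Notation chi := (coding (ifs rho c) V).
Local Notation Jt := (regular_attractor (ifs rho c) V J).
Local Notation gt := (induced_map (ifs rho c) V).
Implicit Types (w u v : seq 'I_m) (x y : nat -> 'I_m) (p q : 'rV[R]_d).

Let chiJ := coding_attractor hrho hJ hV bV.
Let chiS := coding_shift hrho hJ hV bV.

Lemma boundary_openE p : boundary V p <-> closure V p /\ ~ V p.
Proof.
have [oV _ _ _ _] := hV; rewrite /boundary.
by rewrite ((interior_id V).1 oV).
Qed.

Lemma regular_shift_open y n : Jt (chi y) -> V (chi (shiftn n y)).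
Proof.
move=> [_ nb]; apply: contrapT => nV; apply: nb.
exists (mkseq y n) => //; exists (chi (shiftn n y)); last by rewrite -chiS.
apply/boundary_openE; split => //.
by apply: (attractor_sub_closure hrho hJ hV); exact: chiJ.
Qed.

(** Suppose [chi y] is the image under [fw w] of a boundary point [v]. The open image of [V] under
    the prefix [u] of [y] of the same length then meets the image of [V] under [fw w], so [u = w] by
    disjointness. Hence [v] is the coding of a tail of [y] and lies in [V], a contradiction. *)
Lemma regularI y : (forall n, V (chi (shiftn n y))) -> Jt (chi y).
Proof.
move=> Vy; split; first exact: chiJ.
move=> [w _ [v /boundary_openE[cv nVv] e]].
set u := mkseq y (size w).
have eu : chi y = fw u (chi (shiftn (size w) y)) by exact: chiS.
have [oV _ _ _ _] := hV.
have : nbhs v (fw w @^-1` (fw u @` V)).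
  apply: open_nbhs_nbhs; split.
    by apply: open_comp => [p _|]; [exact: fw_continuous|exact: fw_image_open].
  by exists (chi (shiftn (size w) y)) => //; rewrite -eu.
move=> /cv[q [Vq [q' Vq' e']]].
have uw : u = w by apply: (fw_disjoint hrho hV _ Vq' Vq e'); rewrite size_mkseq.
apply: nVv; have -> : v = chi (shiftn (size w) y).
  by apply: (@fw_inj _ _ _ _ c hrho w); rewrite e eu uw.
exact: Vy.
Qed.

Lemma regular_shift y n : Jt (chi y) -> Jt (chi (shiftn n y)).
Proof.
move=> ry; apply: regularI => k; rewrite shiftnD.
exact: regular_shift_open.
Qed.

Lemma regular_coding_inj x y : Jt (chi x) -> chi x = chi y -> x = y.
Proof.
move=> rx e; have ry : Jt (chi y) by rewrite -e.
suff h n : mkseq x n = mkseq y n.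
  apply/funext => n; have /(congr1 (fun s => nth (x 0%N) s n)) := h n.+1.
  by rewrite !nth_mkseq.
apply: (fw_disjoint hrho hV _ (regular_shift_open n rx) (regular_shift_open n ry)).
  by rewrite !size_mkseq.
by rewrite -!chiS.
Qed.

(** The set under [get] contains the coding of the shifted [y], and injectivity at regular points
    excludes any other code. *)
Lemma induced_map_coding y : Jt (chi y) -> gt (chi y) = chi (shiftn 1 y).
Proof.
move=> ry; rewrite /induced_map.
set A := [set _ | _ in _]; have : A (get A).
  apply: (@getPex _ A); exists (chi (Defs.shift y)); exists y => //.
  by split => //= bw; case: ry => _.
move=> [x [nb /= xy] <-]; congr (chi (shiftn 1 _)).
by apply: regular_coding_inj; rewrite xy.
Qed.

Lemma iter_induced_map y k : Jt (chi y) -> iter k gt (chi y) = chi (shiftn k y).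
Proof.
move=> ry; elim: k => [|k IH]; first by rewrite shiftn0.
by rewrite iterS IH induced_map_coding ?shiftnD ?addn1//; exact: regular_shift.
Qed.

Lemma regular_surj p : Jt p -> exists y, p = chi y.
Proof. by case=> + _; exact: (coding_surj hrho hJ hV bV). Qed.

(* Every block of the sets constructed below ends with [w0]: it makes codings
   regular, and it separates distinct blocks by a definite relative distance. *)
Lemma inner_word : exists w0 (k : R), 0 < k /\
  forall p q, J p -> `|fw w0 p - q| < k -> V q.
Proof.
have [oV _ _ _ [v [Vv Jv]]] := hV.
have /nbhs_ballP[e /= e0 eV] : nbhs v V by exact: open_nbhs_nbhs.
have [z vz] := coding_surj hrho hJ hV bV Jv.
have r01 : 0 <= rmax < 1 by have /andP[/ltW -> ->] := rmax01 hrho.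
have [n /(_ n (leqnn n)) hn] := expr_small (2 * M) r01 (divr_gt0 e0 (ltr0n _ 2)).
exists (mkseq z n), (e / 2%:R); split => [|p q Jp hq]; first by rewrite divr_gt0.
apply: eV; rewrite -ball_normE /= -(subrKA (fw (mkseq z n) p)).
rewrite (splitr e) (le_lt_trans (ler_normD _ _))// ltrD//.
apply: le_lt_trans hn; rewrite vz (chiS z n).
have := fw_contract c hrho (mkseq z n)
  (attractor_bound hrho hJ hV bV (chiJ (shiftn n z))) (attractor_bound hrho hJ hV bV
    Jp).
by rewrite size_mkseq.
Qed.

(** Every tail reads [w0] at some later time. There its coding lies in [V], and the letters read
    before that time keep it in [V]. *)
Lemma regular_recurrent w0 y : (forall p, J p -> V (fw w0 p)) ->
  (forall n, exists2 k, (n <= k)%N & mkseq (shiftn k y) (size w0) = w0) ->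
  Jt (chi y).
Proof.
move=> hw0 rec; apply: regularI => n.
have [k nk ek] := rec n.
rewrite (chiS _ (k - n)); apply: (fw_sub_open hV).
by rewrite shiftnD subnKC// (chiS _ (size w0)) ek; apply: hw0; exact: chiJ.
Qed.

Variable x0 : 'rV[R]_d.
Hypothesis Jx0 : J x0.

(** This is B(w) of the overview. Suffixes occur because the shift removes first letters, so the sum
    imitates an orbit sum. *)
Fixpoint word_sum (w : seq 'I_m) : 'rV[R]_d :=
  if w is j :: w' then fw (j :: w') x0 + word_sum w' else 0.

Lemma word_sumS j w : word_sum (j :: w) = fw (j :: w) x0 + word_sum w.
Proof. by []. Qed.

Definition orbit_sum n (y : nat -> 'I_m) := \sum_(0 <= i < n) chi (shiftn i y).

(** The sum of the geometric series of terms 2 M rmax^k: a change of base point inside the bounded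
    set moves the image under a word of length k by at most 2 M rmax^k. *)
Definition defect := 2 * M / (1 - rmax).

Let rmax0 : 0 < rmax. Proof. by have /andP[] := rmax01 hrho. Qed.
Let rmax1 : rmax < 1. Proof. by have /andP[] := rmax01 hrho. Qed.

Lemma bound_ge0 : 0 <= M.
Proof. exact: le_trans (normr_ge0 _) (attractor_bound hrho hJ hV bV Jx0). Qed.

Lemma defect_ge0 : 0 <= defect.
Proof. by rewrite divr_ge0 ?mulr_ge0 ?bound_ge0// subr_ge0 ltW. Qed.

(** The bound with [1 - rmax ^+ n] is a partial sum of the series behind [defect]; this
    strengthening closes the inductions on the length below. *)
Let defect_step n : rmax ^+ n.+1 * (2 * M) + defect * (1 - rmax ^+ n) <= defect * (1
  - rmax ^+ n.+1).
Proof.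
have h : 2 * M = defect * (1 - rmax) by rewrite divfK// gt_eqF// subr_gt0.
rewrite h exprS.
have : 0 <= defect * (rmax ^+ n * (1 - rmax) ^+ 2).
  by rewrite mulr_ge0 ?defect_ge0// mulr_ge0 ?sqr_ge0// exprn_ge0// ltW.
rewrite expr2; lra.
Qed.

Let defect_le n : defect * (1 - rmax ^+ n) <= defect.
Proof.
rewrite -[leRHS]mulr1 ler_wpM2l ?defect_ge0//.
by rewrite lerBlDr lerDl exprn_ge0// ltW.
Qed.

Lemma word_sum_cat u v : `|word_sum (u ++ v) - (word_sum u + word_sum v)| <= defect.
Proof.
suff h : `|word_sum (u ++ v) - (word_sum u + word_sum v)| <= defect * (1 - rmax ^+
  size u).
  exact: le_trans h (defect_le _).
elim: u => [|j u IH]; first by rewrite /= add0r subrr normr0 expr0 subrr mulr0.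
rewrite cat_cons !word_sumS -cat_cons (fw_cat _ _ (j :: u)).
rewrite [X in `|X|](_ : _ = (fw (j :: u) (fw v x0) - fw (j :: u) x0) +
  (word_sum (u ++ v) - (word_sum u + word_sum v))); last first.
  by rewrite -(addrA (fw (j :: u) x0)) opprD addrACA.
apply: le_trans (ler_normD _ _) _; apply: le_trans (defect_step _).
apply: lerD => //; apply: fw_contract => //;
  apply: (attractor_bound hrho hJ hV bV) => //.
exact: fw_attractor.
Qed.

Lemma orbit_sumS n y : orbit_sum n.+1 y = chi y + orbit_sum n (shiftn 1 y).
Proof.
rewrite /orbit_sum big_nat_recl// shiftn0; congr (_ + _).
Qed.

Lemma orbit_sumD n k y : orbit_sum (n + k) y = orbit_sum n y + orbit_sum k (shiftn n y).
Proof.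
elim: n y => [|n IH] y; first by rewrite {2}/orbit_sum big_geq// add0r shiftn0.
by rewrite addSn !orbit_sumS IH addrA shiftnD.
Qed.

Lemma norm_orbit_sum n y : `|orbit_sum n y| <= n%:R * M.
Proof.
apply: le_trans (ler_norm_sum _ _ _) _.
rewrite -[X in _ <= X%:R * _]subn0 -mulr_natl mulr1 mulr_natl -sumr_const_nat.
by apply: ler_sum => i _; apply: (attractor_bound hrho hJ hV bV); exact: chiJ.
Qed.

Lemma orbit_word_sum n y : `|orbit_sum n y - word_sum (mkseq y n)| <= defect.
Proof.
suff h : `|orbit_sum n y - word_sum (mkseq y n)| <= defect * (1 - rmax ^+ n).
  exact: le_trans h (defect_le _).
elim: n y => [|n IH] y.
  by rewrite /orbit_sum big_geq//= subrr normr0 expr0 subrr mulr0.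
rewrite orbit_sumS mkseq_cons word_sumS opprD addrACA.
apply: le_trans (ler_normD _ _) _; apply: le_trans (defect_step _).
apply: lerD => //; rewrite {1}(chiS _ n.+1) mkseq_cons.
have := fw_contract c hrho (y 0%N :: mkseq (shiftn 1 y) n)
  (attractor_bound hrho hJ hV bV (chiJ (shiftn n.+1 y))) (attractor_bound hrho hJ hV
    bV Jx0).
by rewrite /= size_mkseq.
Qed.

Lemma norm_word_sum w : `|word_sum w| <= (size w)%:R * M.
Proof.
elim: w => [|j w IH]; first by rewrite /= normr0 mul0r.
rewrite word_sumS [size _]/= -natr1 mulrDl mul1r addrC.
apply: le_trans (ler_normD _ _) _; apply: lerD => //.
by apply: (attractor_bound hrho hJ hV bV); exact: fw_attractor.
Qed.

Lemma regular_orbit_sum y n : Jt (chi y) ->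
  \sum_(0 <= k < n) iter k gt (chi y) = orbit_sum n y.
Proof.
by move=> ry; apply: eq_bigr => k _; rewrite iter_induced_map.
Qed.

End Regular.

(** * Hausdorff measures and coverings by cylinders *)

Lemma ler_sum_subset (R : realDomainType) (I : eqType) (F : I -> R) (s1 s2 : seq I) :
  (forall i, 0 <= F i) -> uniq s1 -> {subset s1 <= s2} ->
  \sum_(i <- s1) F i <= \sum_(i <- s2) F i.
Proof.
move=> F0; elim: s1 s2 => [|x s1 IH] s2.
  by move=> _ _; rewrite big_nil sumr_ge0.
rewrite cons_uniq => /andP[xs1 us1] ss.
have xs2 : x \in s2 by apply: ss; rewrite mem_head.
rewrite big_cons (perm_big _ (perm_to_rem xs2))/= big_cons lerD2l.
apply: IH => // y ys1; have := ss y; rewrite inE ys1 orbT => /(_ isT).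
rewrite (perm_mem (perm_to_rem xs2)) inE => /orP[/eqP yx|//].
by move: xs1; rewrite -yx ys1.
Qed.

Lemma nneseries_le (R : realType) (u : nat -> \bar R) (B : \bar R) :
  (forall i, 0 <= u i)%E -> (forall n, \sum_(0 <= i < n) u i <= B)%E ->
  (\sum_(0 <= i <oo) u i <= B)%E.
Proof.
move=> u0 h; apply: lime_le; first by apply: is_cvg_nneseries.
exact: nearW.
Qed.

(** Words are enumerated by their codes, and a number that codes no word contributes 0. A finite
    part of the enumeration lies among the words of length below some [L], which are summed length
    by length. *)
Lemma nneseries_words_le (R : realType) (I : finType) (h : seq I -> R)
    (a : nat -> R) (B : R) :
  (forall w, 0 <= h w) -> (forall n, \sum_(t : n.-tuple I) h t <= a n) ->
  (forall L, \sum_(0 <= n < L) a n <= B) ->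
  (\sum_(0 <= k <oo) (oapp h 0 (pickle_inv k))%:E <= B%:E)%E.
Proof.
move=> h0 ha aB; apply: nneseries_le => [k|K].
  by rewrite lee_fin; case: (pickle_inv k : option (seq I)) => [w|] //=.
rewrite sumEFin lee_fin -big_pmap.
set s := pmap _ _.
have us : uniq s by apply: (pmap_uniq (@pickle_invK _)); exact: iota_uniq.
pose L := (\max_(w <- s) size w).+1.
pose s2 := flatten [seq [seq val t | t : n.-tuple I] | n <- iota 0 L].
apply: (@le_trans _ _ (\sum_(w <- s2) h w)).
  apply: ler_sum_subset => // w ws; apply/flattenP.
  exists [seq val t | t : (size w).-tuple I].
    apply: (map_f (fun n => [seq val t | t : n.-tuple I])).
    rewrite mem_iota add0n ltnS /=.
    by rewrite (bigD1_seq w)//= leq_maxl.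
  by apply/mapP; exists (in_tuple w) => //; rewrite mem_enum.
rewrite /s2 big_flatten big_map; apply: le_trans (aB L).
rewrite /index_iota subn0; apply: ler_sum => n _.
by rewrite big_map big_enum.
Qed.

Section Hausdorff.
Variables (R : realType) (d : nat).
Implicit Types (A X : set 'rV[R]_d) (s : R).

Lemma gauge_ge0 s A : (0 <= hausdorff_gauge s A)%E.
Proof. by rewrite /hausdorff_gauge; case: ifP => // _; exact: poweR_ge0. Qed.

Lemma ediam_ge0 A : A !=set0 -> (0 <= ediam A)%E.
Proof.
move=> [p Ap]; apply: ereal_sup_ubound; exists (p, p) => //=.
by rewrite /Defs.edist big1 ?sqrtr0// => i _; rewrite subrr expr0n.
Qed.

Lemma ediam_le A (D : R) : (forall p q, A p -> A q -> edist p q <= D) ->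
  (ediam A <= D%:E)%E.
Proof. by move=> h; apply: ge_ereal_sup => _ [[p q] [/= Ap Aq] <-];
  rewrite lee_fin h. Qed.

Lemma gauge_le s A (D : R) : 0 <= s -> 0 <= D ->
  (forall p q, A p -> A q -> edist p q <= D) ->
  (hausdorff_gauge s A <= (D `^ s)%:E)%E.
Proof.
move=> s0 D0 h; rewrite /hausdorff_gauge; case: ifPn => [_|].
  by rewrite lee_fin powR_ge0.
move=> /set0P A0; rewrite -poweR_EFin gt0_ler_poweR// ?in_itv/= ?leey ?andbT.
- exact: ediam_ge0.
- by rewrite lee_fin.
- exact: ediam_le.
Qed.

Lemma premeasure_ge0 s delta X : (0 <= hausdorff_premeasure s delta X)%E.
Proof.
apply: le_ereal_inf_tmp => _ [U _ <-].
by apply: nneseries_ge0 => *; exact: gauge_ge0.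
Qed.

Lemma hausdorff_measure_eq0 s X :
  (forall delta e, 0 < delta -> 0 < e -> exists U : nat -> set 'rV[R]_d,
    [/\ X `<=` \bigcup_i U i, forall i, (ediam (U i) <= delta%:E)%E &
        (\sum_(0 <= i <oo) hausdorff_gauge s (U i) <= e%:E)%E]) ->
  hausdorff_measure s X = 0%E.
Proof.
move=> h; apply/eqP; rewrite eq_le; apply/andP; split; last first.
  apply: (@le_trans _ _ (hausdorff_premeasure s 1 X)); first exact: premeasure_ge0.
  by apply: ereal_sup_ubound; exists 1 => //=.
apply: ge_ereal_sup => _ [delta /= d0 <-].
apply/lee_addgt0Pr => e e0; rewrite add0e.
have [U [XU Ud Ue]] := h _ _ d0 e0.
by apply: le_trans Ue; apply: ereal_inf_lbound; exists U.
Qed.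

Lemma hausdorff_measure0_cover s X (e : R) : 0 < e -> hausdorff_measure s X = 0%E ->
  exists U : nat -> set 'rV[R]_d,
    [/\ X `<=` \bigcup_i U i, forall i, (ediam (U i) <= 1%:E)%E &
        (\sum_(0 <= i <oo) hausdorff_gauge s (U i) < e%:E)%E].
Proof.
move=> e0 h; have : (hausdorff_premeasure s 1 X < e%:E)%E.
  apply: (@le_lt_trans _ _ 0%E); last by rewrite lte_fin.
  by rewrite -h; apply: ereal_sup_ubound; exists 1 => //=.
by move=> /ereal_inf_lt[_ [U [XU Ud] <-] lte]; exists U.
Qed.

Lemma hausdorff_dim_ge0 X : (0 <= hausdorff_dim X)%E.
Proof. by apply: le_ereal_inf_tmp => _ [s [s0 _] <-]; rewrite lee_fin. Qed.

Lemma hausdorff_dim_le s X : 0 <= s ->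
  (forall t, s < t -> hausdorff_measure t X = 0%E) -> (hausdorff_dim X <= s%:E)%E.
Proof.
move=> s0 h; apply/lee_addgt0Pr => e e0; apply: ereal_inf_lbound.
exists (s + e) => //; split; first by rewrite addr_ge0// ltW.
by apply: h; rewrite ltrDl.
Qed.

Lemma hausdorff_dim_ge s X :
  (forall t, 0 <= t < s -> hausdorff_measure t X != 0%E) -> (s%:E <= hausdorff_dim X)%E.
Proof.
move=> h; apply: le_ereal_inf_tmp => _ [t [t0 ht] <-]; rewrite lee_fin leNgt.
by apply/negP => ts; have := h t; rewrite t0 ts ht eqxx => /(_ isT).
Qed.

Lemma hausdorff_measure0_sub s X A : X `<=` A ->
  hausdorff_measure s A = 0%E -> hausdorff_measure s X = 0%E.
Proof.
move=> XA h; apply: hausdorff_measure_eq0 => delta e d0 e0.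
have : (hausdorff_premeasure s delta A < e%:E)%E.
  apply: (@le_lt_trans _ _ 0%E); last by rewrite lte_fin.
  by rewrite -h; apply: ereal_sup_ubound; exists delta => //=.
move=> /ereal_inf_lt[_ [U [AU Ud] <-] lte]; exists U; split => //.
- exact: subset_trans AU.
- exact: ltW.
Qed.

Lemma hausdorff_dim_sub X A : X `<=` A -> (hausdorff_dim X <= hausdorff_dim A)%E.
Proof.
move=> XA; apply: ereal_inf_le_tmp => _ [s [s0 h] <-]; exists s => //; split => //.
exact: hausdorff_measure0_sub h.
Qed.

End Hausdorff.

(** * Null sets from coverings by cylinders *)

Section Covering.
Variables (R : realType) (d m : nat) (rho : 'I_m -> R) (c : 'I_m -> 'rV[R]_d).
Variables (J : set 'rV[R]_d) (M : R).
Hypothesis hrho : forall j, 0 < rho j < 1.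
Hypothesis bJ : forall p, J p -> `|p| <= M.
Local Notation fw := (word_map (ifs rho c)).
Local Notation ratio := (ratio rho).
Local Notation rmax := (rmax rho).

Lemma edist_cylinder w p q : J p -> J q ->
  edist (fw w p) (fw w q) <= ratio w * (d%:R * (2 * `|M|) + 1).
Proof.
move=> Jp Jq; rewrite fwE (fwE _ _ w q) edist_scale ?(ltW (ratio_gt0 hrho w))//.
rewrite ler_wpM2l ?(ltW (ratio_gt0 hrho w))//;
  apply: (@le_trans _ _ (d%:R * (2 * `|M|))).
  apply: le_trans (edist_le_norm _ _) _; rewrite ler_wpM2l//.
  rewrite (le_trans (ler_normB _ _))// mulr_natl mulr2n lerD//.
    exact: le_trans (bJ Jp) (ler_norm _).
  exact: le_trans (bJ Jq) (ler_norm _).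
by rewrite lerDl.
Qed.

(** The cylinders of all long words in [G] cover [X]. The excess exponent [t - s] multiplies the sum
    at length n by at most [rmax] to the power n (t - s), so the total is a small geometric tail. *)
Lemma limsup_cover_null (X : set 'rV[R]_d) (G : pred (seq 'I_m)) (s t C : R) (N0 :
  nat) :
  0 <= s < t ->
  (forall p, X p -> forall N, exists w, [/\ (N <= size w)%N, G w & (fw w @` J) p]) ->
  (forall n, (N0 <= n)%N -> \sum_(w : n.-tuple 'I_m | G w) ratio w `^ s <= C) ->
  hausdorff_measure t X = 0%E.
Proof.
move=> /andP[s0 st] hX hG; have t0 := le_lt_trans s0 st.
have [r0 r1] := andP (rmax01 hrho).
set D := d%:R * (2 * `|M|) + 1.
have D0 : 0 < D by rewrite ltr_wpDl// mulr_ge0.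
set r := rmax `^ (t - s).
have r0' : 0 < r by exact: powR_gt0.
have r1' : r < 1.
  rewrite [ltRHS](_ : 1 = 1 `^ (t - s)); last by rewrite powR1.
  by rewrite gt0_ltr_powR ?nnegrE ?subr_gt0// ltW.
apply: hausdorff_measure_eq0 => delta e d0 e0.
have [n1 hn1] := expr_small D (introT andP (conj (ltW r0) r1)) d0.
set E := D `^ t * `|C| / (1 - r).
have [n2 hn2] := expr_small E (introT andP (conj (ltW r0') r1')) e0.
pose N1 := maxn N0 (maxn n1 n2).
pose P w := (N1 <= size w)%N && G w.
pose h w := if P w then (ratio w * D) `^ t else 0.
pose U k := oapp (fun w => if P w then fw w @` J else set0) set0 (pickle_inv k :
  option (seq 'I_m)).
(* Zero below [N1], and the n-th geometric term from [N1] on; as a difference it telescopes. *)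
pose a n := E * (r ^+ maxn n N1 - r ^+ maxn n.+1 N1).
exists U; split.
- move=> p /hX /(_ N1)[w [Nw Gw Jw]]; exists (pickle w) => //.
  by rewrite /U pickleK_inv /= /P Nw Gw.
- move=> k; rewrite /U; case: (pickle_inv k : option (seq 'I_m)) => [w|] /=; last first.
    by apply: ediam_le.
  case: ifP => [/andP[Nw _]|_]; last by apply: ediam_le.
  apply: ediam_le => _ _ [p Jp <-] [q Jq <-].
  apply: le_trans (edist_cylinder w Jp Jq) _.
  apply/ltW; apply: le_lt_trans (hn1 (size w) _).
    by rewrite ler_wpM2r ?(ltW D0)// ratio_le.
  by apply: leq_trans Nw; rewrite leq_max leq_max leqnn !orbT.
- apply: (@le_trans _ _ (\sum_(0 <= k <oo) (oapp h 0 (pickle_inv k))%:E)%E).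
    apply: lee_nneseries => [k _ _|k _]; first exact: gauge_ge0.
    rewrite /U; case: (pickle_inv k : option (seq 'I_m)) => [w|] /=; last first.
      by rewrite /hausdorff_gauge eqxx.
    rewrite /h; case: ifP => [Pw|_]; last by rewrite /hausdorff_gauge eqxx.
    apply: gauge_le; first exact: ltW.
      by rewrite mulr_ge0 ?ltW// ratio_gt0.
    by move=> _ _ [p Jp <-] [q Jq <-]; exact: edist_cylinder.
  apply: (@nneseries_words_le _ _ h a).
  + by move=> w; rewrite /h; case: ifP => // _; exact: powR_ge0.
  + move=> n; rewrite /a /h -big_mkcond /=.
    have [nN|Nn] := ltnP n N1.
      rewrite big1 => [|w]; last by rewrite /P size_tuple leqNgt nN.
      by rewrite (maxn_idPr nN) subrr mulr0.
    rewrite (maxn_idPl (leqW Nn)).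
    have -> : E * (r ^+ n - r ^+ n.+1) = D `^ t * r ^+ n * `|C|.
      by rewrite /E exprS; field; rewrite gt_eqF// subr_gt0.
    apply: (@le_trans _ _ (\sum_(w : n.-tuple 'I_m | G w) D `^ t * r ^+ n * ratio w
      `^ s)).
      rewrite (eq_bigl (fun w : n.-tuple 'I_m => G w)); last first.
        by move=> w; rewrite /P size_tuple Nn.
      apply: ler_sum => w _.
      rewrite powRM ?(ltW D0) ?(ltW (ratio_gt0 hrho w))// mulrC -mulrA ler_wpM2l
        ?powR_ge0//.
      rewrite -{1}(subrK s t) powRD; last by rewrite (gt_eqF (ratio_gt0 _ _)) ?implybT.
      rewrite ler_wpM2r ?powR_ge0// /r -powR_mulrn ?powR_ge0// -powRrM mulrC powRrM.
      rewrite powR_mulrn ?(ltW r0)// ge0_ler_powR ?nnegrE ?exprn_ge0 ?(ltW r0)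
        ?subr_ge0 ?(ltW st) ?(ltW (ratio_gt0 hrho w))//.
      by have := ratio_le hrho w; rewrite size_tuple.
    rewrite -mulr_sumr ler_wpM2l ?mulr_ge0 ?powR_ge0 ?exprn_ge0 ?(ltW r0')//.
    apply: le_trans (hG n _) (ler_norm _).
    by apply: leq_trans Nn; rewrite leq_max leqnn.
  + move=> L; rewrite -mulr_sumr (_ : \sum_(0 <= n < L) _ = r ^+ N1 - r ^+ maxn L N1).
      apply: (@le_trans _ _ (E * r ^+ N1)).
        rewrite ler_wpM2l ?gerBl ?exprn_ge0 ?(ltW r0')//.
        by rewrite divr_ge0 ?mulr_ge0 ?powR_ge0// subr_ge0 ltW.
      rewrite mulrC; apply/ltW/hn2.
      by rewrite leq_max leq_max leqnn !orbT.
    have := @telescope_sumr _ 0 L (fun n => - r ^+ maxn n N1) (leq0n L).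
    rewrite max0n opprK addrC => <-.
    by apply: eq_bigr => i _; rewrite opprK addrC.
Qed.

End Covering.

(** * A lower bound for the dimension of strongly separated Moran sets *)

Section Radius.
Variables (R : realType) (d : nat).
Implicit Types (A : set 'rV[R]_d).

(** The diameter serves as radius unless it is 0. In that case the slack [e] pays for a positive
    radius, except at exponent 0, where the gauge is already 1. *)
Lemma gauge_radius (t e : R) A : 0 <= t -> 0 < e -> (ediam A <= 1)%E ->
  exists r : R, [/\ 0 < r, forall p q, A p -> A q -> `|p - q| <= r &
    A !=set0 -> ((r `^ t)%:E <= hausdorff_gauge t A + e%:E)%E].
Proof.
move=> t0 e0 A1.
have [A0|] := pselect (A !=set0); last first.
  by move=> nA; exists 1; split => // p q Ap; exfalso; apply: nA; exists p.
have dA := ediam_ge0 A0.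
have [D DE] : exists D : R, ediam A = D%:E.
  by case: (ediam A) dA A1 => // D _ _; exists D.
have D0 : 0 <= D by move: dA; rewrite DE lee_fin.
have hD p q : A p -> A q -> `|p - q| <= D.
  move=> Ap Aq; apply: le_trans (norm_le_edist _ _) _.
  rewrite -lee_fin -DE; apply: ereal_sup_ubound.
  by exists (p, q).
have gE : hausdorff_gauge t A = (D `^ t)%:E.
  by rewrite /hausdorff_gauge (negbTE ((set0P _).2 A0)) DE poweR_EFin.
have [Dp|] := ltP 0 D.
  by exists D; split => // _; rewrite gE -EFinD lee_fin lerDl ltW.
move=> Dn; have {Dn} D00 : D = 0 by apply/eqP; rewrite eq_le Dn D0.
have [t00|tn0] := eqVneq t 0.
  exists 1; split => // [p q Ap Aq|_]; first by rewrite (le_trans (hD _ _ Ap Aq))// D00.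
  by rewrite gE t00 !powRr0 -EFinD lee_fin lerDl ltW.
exists (e `^ t^-1); split => [|p q Ap Aq|_]; first exact: powR_gt0.
  by rewrite (le_trans (hD _ _ Ap Aq))// D00 powR_ge0.
rewrite gE D00 powR0// add0e -powRrM mulVf// powRr1 ?(ltW e0)//.
Qed.

End Radius.

Section Moran.
Variables (R : realType) (d m : nat) (rho : 'I_m -> R) (c : 'I_m -> 'rV[R]_d).
Variables (J V : set 'rV[R]_d) (M : R).
Hypothesis hrho : forall j, 0 < rho j < 1.
Hypothesis hJ : is_attractor (ifs rho c) J.
Hypothesis hV : sosc (ifs rho c) J V.
Hypothesis bV : forall p, V p -> `|p| <= M.
Local Notation fw := (word_map (ifs rho c)).
Local Notation ratio := (ratio rho).
Local Notation rmin := (rmin rho).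
Local Notation chi := (coding (ifs rho c) V).

Variables (w0 : seq 'I_m) (kap0 : R).
Hypothesis kap0_gt0 : 0 < kap0.
Hypothesis hw0 : forall p q, J p -> `|fw w0 p - q| < kap0 -> V q.

Variables (G : finType) (wd : seq G -> G -> seq 'I_m) (b0 : nat).
Hypothesis wd_size : forall s g, size (wd s g) = b0.
Hypothesis wd_inj : forall s, injective (wd s).
Hypothesis b_gt0 : (0 < b0 + size w0)%N.
Variable u : seq G -> seq 'I_m.
Hypothesis u_rcons : forall s g, u (rcons s g) = u s ++ wd s g ++ w0.
Variable i0 : 'I_m.

(** Blocks are nonempty, so the word after n + 1 choices has a letter at position n and the default
    [i0] is never reached. *)
Definition branch (sg : nat -> G) : nat -> 'I_m :=
  fun n => nth i0 (u (mkseq sg n.+1)) n.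

Local Notation b := (b0 + size w0)%N.

Lemma u_size s : size (u s) = (size (u [::]) + size s * b)%N.
Proof.
elim/last_ind: s => [|s g IH]; first by rewrite mul0n addn0.
by rewrite u_rcons !size_cat wd_size IH size_rcons mulSnr -addnA.
Qed.

Lemma u_prefix sg k l : (k <= l)%N -> exists v, u (mkseq sg l) = u (mkseq sg k) ++ v.
Proof.
move=> /subnK <-; elim: (l - k)%N => [|n [v e]]; first by exists [::]; rewrite cats0.
by rewrite addSn mkseqS u_rcons e -catA; eexists.
Qed.

Lemma mkseq_branch sg k : mkseq (branch sg) (size (u (mkseq sg k))) = u (mkseq sg k).
Proof.
apply: (@eq_from_nth _ i0); rewrite size_mkseq// => i ilt.
rewrite nth_mkseq// /branch.
have si : (i < size (u (mkseq sg i.+1)))%N.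
  by rewrite u_size size_mkseq (leq_trans _ (leq_addl _ _))// leq_pmulr.
have [ki|ik] := leqP k i.+1.
  by have [v ->] := u_prefix sg ki; rewrite nth_cat ilt.
by have [v ->] := u_prefix sg (ltnW ik); rewrite nth_cat si.
Qed.

Let kap := rmin ^+ b0 * kap0.

Let kap_gt0 : 0 < kap.
Proof. by rewrite mulr_gt0// exprn_gt0//; have /andP[] := rmin01 hrho. Qed.

Lemma branch_coding sg k : exists2 p, J p &
  chi (branch sg) = fw (u (mkseq sg k)) (fw (wd (mkseq sg k) (sg k)) (fw w0 p)).
Proof.
have [p Jp pE] := codingP hrho hJ hV bV (branch sg) (size (u (mkseq sg k.+1))).
by exists p => //; rewrite pE mkseq_branch mkseqS u_rcons !fw_cat.
Qed.

Lemma branch_separated sg sg' k : mkseq sg k = mkseq sg' k -> sg k != sg' k ->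
  ratio (u (mkseq sg k)) * kap <= `|chi (branch sg) - chi (branch sg')|.
Proof.
move=> e ne; have [p Jp ->] := branch_coding sg k.
have [q Jq ->] := branch_coding sg' k; rewrite -e.
rewrite fwB normrZ gtr0_norm ?ratio_gt0// ler_wpM2l ?(ltW (ratio_gt0 hrho _))//.
rewrite leNgt; apply/negP => h.
set w := wd _ (sg k) in h; set w' := wd _ (sg' k) in h.
have Vq : V (fw w0 q) by apply: (hw0 Jq); rewrite subrr normr0.
pose z := fwV rho c w (fw w' (fw w0 q)).
have Vz : V z.
  apply: (hw0 Jp); move: h; rewrite -(fwVK c hrho w (fw w' _)) -/z fwB normrZ.
  rewrite gtr0_norm ?ratio_gt0// => h.
  rewrite -(ltr_pM2l (ratio_gt0 hrho w)); apply: lt_le_trans h _.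
  rewrite ler_wpM2r ?(ltW kap0_gt0)//.
  by have := ratio_ge hrho w; rewrite wd_size.
have ww' : w = w'.
  apply: (fw_disjoint hrho hV _ Vz Vq); first by rewrite !wd_size.
  by rewrite fwVK.
by move: ne; rewrite (wd_inj ww') eqxx.
Qed.

(** A mass distribution argument without a measure. From a cover of small total gauge, a branch is
    built along which the cover elements charging the current cylinder always weigh less than its
    ratio to the power [t]; the cover element containing the end point contradicts this. *)
Lemma moran_measure_neq0 t : 0 <= t ->
  (forall s, 1 <= \sum_g ratio (wd s g ++ w0) `^ t) ->
  hausdorff_measure t [set chi (branch sg) | sg in [set: nat -> G]] != 0%E.
Proof.
move=> t0 hsum; apply/negP => /eqP H0.
(* Half of the critical value: the gauges cost less than [e], and the slacks in the radii cost
   another [e]. *)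
pose e := kap `^ t * ratio (u [::]) `^ t / 2.
have e0 : 0 < e by rewrite divr_gt0// mulr_gt0// powR_gt0// ratio_gt0.
have [U [XU U1 Ue]] := hausdorff_measure0_cover e0 H0.
have /choice[r hr] : forall i, exists r : R, [/\ 0 < r,
    forall p q, U i p -> U i q -> `|p - q| <= r &
    U i !=set0 -> ((r `^ t)%:E <= hausdorff_gauge t (U i) + (e / (2 ^ i.+1)%:R)%:E)%E].
  move=> i; apply: gauge_radius => //.
  by rewrite divr_gt0// ltr0n expn_gt0.
(* [E i s]: the cylinder [s] contains the cylinder at which a branch meeting
   [U i] first has size comparable to [r i]; separation makes that branch unique
   up to this level, so the masses [a i] descend to at most one child. *)
pose E i s := exists sg, [/\ U i (chi (branch sg)), mkseq sg (size s) = s &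
  forall s' g, s = rcons s' g -> r i < kap * ratio (u s')].
pose a i := (r i / kap) `^ t.
have a0 i : 0 <= a i by exact: powR_ge0.
pose Ms s := (\sum_(0 <= i <oo) (if `[< E i s >] then a i else 0)%:E)%E.
pose P s := (Ms s < (ratio (u s) `^ t)%:E)%E.
have term0 i s : (0 <= (if `[< E i s >] then a i else 0)%:E)%E.
  by rewrite lee_fin; case: ifP.
have P0 : P [::].
  apply: (@le_lt_trans _ _ (((kap `^ t)^-1)%:E *
     \sum_(0 <= i <oo) (hausdorff_gauge t (U i) + (e / (2 ^ i.+1)%:R)%:E))%E).
    rewrite -nneseriesZl => [|i _]; last first.
      rewrite adde_ge0 ?gauge_ge0// lee_fin divr_ge0 ?(ltW e0)//.
    apply: lee_nneseries => [i _ _|i _]; first exact: term0.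
    case: ifPn => [/asboolP[sg [Ui _ _]]|_]; last first.
      by rewrite mule_ge0 ?lee_fin ?invr_ge0 ?powR_ge0// adde_ge0 ?gauge_ge0//
        lee_fin divr_ge0 ?(ltW e0).
    have [ri _ /(_ (ex_intro _ _ Ui)) hri] := hr i.
    rewrite /a powRM ?invr_ge0 ?(ltW ri) ?(ltW kap_gt0)//.
    rewrite -[kap^-1]powR_inv1 ?(ltW kap_gt0)// -powRrM mulN1r powRN mulrC EFinM.
    by rewrite lee_wpmul2l// lee_fin invr_ge0 powR_ge0.
  rewrite lte_pdivrMl ?powR_gt0// -EFinM.
  apply: le_lt_trans (epsilon_trick _ (fun i => gauge_ge0 _ _) (ltW e0)) _.
  rewrite (_ : kap `^ t * _ = e + e); last by rewrite /e; field.
  by rewrite EFinD lte_leD.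
(* If all children failed, their charges would add up to at least the ratio of [u s] to the power
   [t]; but each [U i] charging a child charges no other child, and charges [s] as well. *)
have stepP s : P s -> exists g, P (rcons s g).
  move=> Ps; apply: contrapT => /forallNP nP.
  move: Ps; rewrite /P; apply/negP; rewrite -leNgt.
  apply: (@le_trans _ _ (\sum_g Ms (rcons s g))%E).
    apply: (@le_trans _ _ (\sum_g (ratio (u (rcons s g)) `^ t)%:E)%E).
      rewrite sumEFin lee_fin -[leLHS]mulr1.
      apply: (@le_trans _ _ (ratio (u s) `^ t * \sum_g ratio (wd s g ++ w0) `^ t)).
        by rewrite ler_wpM2l ?powR_ge0.
      rewrite mulr_sumr; apply: ler_sum => g _.
      by rewrite u_rcons (ratio_cat _ (u s)) powRM ?lexx// (ltW (ratio_gt0 hrho _)).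
    by apply: lee_sum => g _; rewrite leNgt; apply/negP; exact: nP.
  rewrite /Ms -nneseries_sum => [|g i _]; last exact: term0.
  apply: lee_nneseries => [i _ _|i _].
    by rewrite sumEFin lee_fin sumr_ge0// => g _; case: ifP.
  rewrite sumEFin lee_fin.
  have [[g Eg]|] := pselect (exists g, E i (rcons s g)); last first.
    move=> /forallNP nE; rewrite big1 => [|g _].
      by case: ifP.
    by case: ifPn => // /asboolP /nE.
  have rs : r i < kap * ratio (u s) by have [sg [_ _ /(_ s g erefl)]] := Eg.
  have Es : E i s.
    have [sg [Ui esg _]] := Eg; exists sg; split => //.
      by move: esg; rewrite size_rcons mkseqS => /rcons_inj[].
    move=> s' g' ss'; apply: lt_le_trans rs _.
    rewrite ler_wpM2l ?(ltW kap_gt0)// ss' u_rcons ratio_cat.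
    rewrite -[leRHS]mulr1 ler_wpM2l ?(ltW (ratio_gt0 hrho _))//.
    have [r0 r1] := andP (rmax01 hrho).
    by apply: le_trans (ratio_le hrho _) _; rewrite exprn_ile1// ltW.
  rewrite (asboolT Es) (bigD1 g)//= (asboolT Eg) big1 ?addr0// => g' g'g.
  case: ifPn => // /asboolP[sg' [Ui' e' _]]; exfalso.
  have [sg [Ui esg _]] := Eg.
  move: esg e'; rewrite !size_rcons !mkseqS => /rcons_inj[es eg] /rcons_inj[es' eg'].
  have [_ /(_ _ _ Ui Ui') hle _] := hr i.
  have := @branch_separated sg sg' (size s);
    rewrite es es' eg eg' eq_sym => /(_ erefl g'g).
  by move=> /le_trans/(_ hle); rewrite leNgt mulrC rs.
have [g0 _] := stepP _ P0.
have /choice[F hF] : forall s, exists g, P s -> P (rcons s g).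
  move=> s; have [/stepP[g Pg]|nP] := pselect (P s); first by exists g.
  by exists g0.
pose cs := fix cs n := if n is k.+1 then rcons (cs k) (F (cs k)) else [::] : seq G.
pose sg n := F (cs n).
have csE n : mkseq sg n = cs n by elim: n => [//|n IH]; rewrite mkseqS IH.
have Pcs n : P (cs n) by elim: n => [//|n IH] /=; exact: hF.
have [i _ Ui] := XU (chi (branch sg)) (ex_intro2 _ _ sg Logic.I erefl).
have [ri _ _] := hr i.
have [r0 r1] := andP (rmax01 hrho).
have ex : exists k, kap * ratio (u (cs k)) <= r i.
  have [n hn] := expr_small kap (introT andP (conj (ltW r0) r1)) ri.
  exists n; rewrite mulrC; apply/ltW; apply: le_lt_trans (hn (size (u (cs n))) _).
    by rewrite ler_wpM2r ?(ltW kap_gt0)// ratio_le.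
  by rewrite u_size -csE size_mkseq (leq_trans _ (leq_addl _ _))// leq_pmulr.
(* At the first level whose size drops to [r i], the parent is still larger, so [U i] charges this
   node; its weight [a i] alone exceeds what [Pcs k] permits. *)
have := ex_minnP ex => -[k hk kmin].
have Ek : E i (cs k).
  exists sg; split => //; first by rewrite -[in size _]csE size_mkseq csE.
  move=> s' g ss'; rewrite ltNge; apply/negP => h.
  case: k ss' {hk} kmin => [|k] /=; first by case: s' {h}.
  by move=> /rcons_inj[es' _] /(_ k); rewrite es' => /(_ h); rewrite ltnn.
have := Pcs k; rewrite /P; apply/negP; rewrite -leNgt.
rewrite /Ms (@nneseriesD1 _ _ i)//.
rewrite (asboolT Ek); apply: (@le_trans _ _ (a i)%:E); last first.
  by rewrite leeDl// nneseries_ge0.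
rewrite lee_fin ge0_ler_powR ?nnegrE ?(ltW (ratio_gt0 hrho _))//.
  by rewrite divr_ge0 ?(ltW ri) ?(ltW kap_gt0).
by rewrite ler_pdivlMr// mulrC.
Qed.

End Moran.

(** * Steering Birkhoff sums *)

Section Potential.
Variables (R : realType) (d : nat).
Implicit Types (S a : 'rV[R]_d).

(** The first term bounds |S|^2 while the inward pull is too weak to absorb |a|^2; the second bounds
    |a|^2. *)
Definition potential_bound (A : R) : R := (d%:R * A ^+ 2 / 2) ^+ 2 + d%:R * A ^+ 2.

(* |S + a|^2 = |S|^2 + 2 <S, a> + |a|^2, so a bounded step that points inwards
   cannot increase |S| once S is large. *)
Lemma potential_step S a (A B : R) : 0 <= A -> `|a| <= A -> dot S a <= - norm1 S ->
  potential_bound A <= B -> dot S S <= B -> dot (S + a) (S + a) <= B.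
Proof.
move=> A0 aA Sa AB SB.
have E : dot (S + a) (S + a) = dot S S + 2 * dot S a + dot a a.
  by rewrite dotDr (dotC _ S) (dotC _ a) !dotDr (dotC a S); ring.
have aa : dot a a <= d%:R * A ^+ 2.
  apply: le_trans (dot_le_norm1 _ _) _; rewrite expr2 mulrA ler_pM ?norm1_ge0//.
  by apply: le_trans (norm1_le _) _; rewrite ler_wpM2l.
have S0 := norm1_ge0 S.
rewrite E; have [h|h] := leP (d%:R * A ^+ 2 / 2) (norm1 S); first by lra.
apply: le_trans AB; rewrite /potential_bound.
have := dot_self_le S; have : norm1 S ^+ 2 <= (d%:R * A ^+ 2 / 2) ^+ 2.
  by rewrite lerXn2r ?nnegrE ?(ltW h)// (le_trans S0 (ltW h)).
lra.
Qed.

Lemma bounded_drift_cvg (x : nat -> 'rV[R]_d) (p : 'rV[R]_d) (C : R) :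
  (forall n, `|x n - n%:R *: p| <= C) -> (n%:R^-1 : R) *: x n @[n --> \oo] --> p.
Proof.
move=> h; apply/cvgrPdist_lt => e e0.
have Cge0 : 0 <= C by exact: le_trans (normr_ge0 _) (h 0%N).
exists (Num.bound (C / e)).+1 => // n /= nN.
have n0 : (0 < n%:R :> R) by rewrite ltr0n (leq_trans _ nN).
have -> : p - n%:R^-1 *: x n = n%:R^-1 *: (n%:R *: p - x n).
  by rewrite scalerBr scalerA mulVf ?scale1r// gt_eqF.
rewrite normrZ gtr0_norm ?invr_gt0// distrC mulrC ltr_pdivrMr//.
apply: le_lt_trans (h n) _; rewrite mulrC -ltr_pdivrMr//.
apply: lt_le_trans (archi_boundP (divr_ge0 Cge0 (ltW e0))) _.
by rewrite ler_nat ltnW.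
Qed.

End Potential.

(** * A Moran construction with controlled orbit sums *)

Section Steering.
Variables (R : realType) (d m : nat) (rho : 'I_m -> R) (c : 'I_m -> 'rV[R]_d).
Variables (J V : set 'rV[R]_d) (M : R).
Hypothesis hrho : forall j, 0 < rho j < 1.
Hypothesis hJ : is_attractor (ifs rho c) J.
Hypothesis hV : sosc (ifs rho c) J V.
Hypothesis bV : forall p, V p -> `|p| <= M.
Local Notation fw := (word_map (ifs rho c)).
Local Notation ratio := (ratio rho).
Local Notation rmax := (rmax rho).
Local Notation rmin := (rmin rho).
Local Notation chi := (coding (ifs rho c) V).
Local Notation defect := (defect rho M).
Variable x0 : 'rV[R]_d.
Hypothesis Jx0 : J x0.
Local Notation word_sum := (word_sum rho c x0).
Local Notation orbit_sum := (orbit_sum rho c V).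

Definition fixpt (j : 'I_m) : 'rV[R]_d := chi (fun _ => j).

Lemma word_sum_nseq j l : `|word_sum (nseq l j) - l%:R *: fixpt j| <= defect.
Proof.
have := orbit_word_sum hrho hJ hV bV Jx0 l (fun _ => j).
rewrite distrC (_ : mkseq _ l = nseq l j); last first.
  by rewrite /mkseq; elim: l 0%N => [//|l IH] k /=; rewrite IH.
rewrite /orbit_sum (eq_bigr (fun _ => fixpt j))//.
by rewrite sumr_const_nat subn0 scaler_nat.
Qed.

(* Points whose orbit sums stay at bounded distance from [n * beta y]; [beta]
   will be a constant for a level set and the coding map for the fixed averages. *)
Definition drift_set (w0 u0 : seq 'I_m) (beta : (nat -> 'I_m) -> 'rV[R]_d) :
    set 'rV[R]_d :=
  [set chi y | y in [set y | [/\ mkseq y (size u0) = u0,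
    forall n, exists2 k, (n <= k)%N & mkseq (shiftn k y) (size w0) = w0 &
    exists C, forall n, `|orbit_sum n y - n%:R *: beta y| <= C]]].

Variables (w0 : seq 'I_m) (kap0 : R).
Hypothesis kap0_gt0 : 0 < kap0.
Hypothesis hw0 : forall p q, J p -> `|fw w0 p - q| < kap0 -> V q.

Variables (G : finType) (n l : nat) (gw : G -> seq 'I_m).
Hypothesis gw_size : forall g, size (gw g) = n.
Hypothesis gw_inj : injective gw.
Hypothesis b_gt0 : (0 < n + l + size w0)%N.
Local Notation b := (n + l + size w0)%N.

(** [tau v] is the estimate of the target available once the prefix [v] is known; it approaches the
    final target [beta y] geometrically. *)
Variables (u0 : seq 'I_m) (tau : seq 'I_m -> 'rV[R]_d) (Mt Ct : R).
Variable beta : (nat -> 'I_m) -> 'rV[R]_d.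
Hypothesis tau_bound : forall v, prefix u0 v -> `|tau v| <= Mt.
Hypothesis tau_beta : forall y k, mkseq y (size u0) = u0 -> (size u0 <= k)%N ->
  `|tau (mkseq y k) - beta y| <= Ct * rmax ^+ k.

(** Three concatenations and the replacement of a power of a letter by copies of its fixed point
    cost one [defect] each; the letters of [w0] cost the second term. The final 1 remains as inward
    pull. *)
Definition steering_margin := 4 * defect + (size w0)%:R * (M + Mt) + 1.

Hypothesis steer : forall g S v, prefix u0 v -> exists j,
  dot S (word_sum (gw g) + l%:R *: fixpt j - (n + l)%:R *: tau v) <=
    - (steering_margin * norm1 S).

Let Mt_ge0 : 0 <= Mt.
Proof. exact: le_trans (normr_ge0 _) (tau_bound (prefix_refl u0)). Qed.

Let Mge0 := bound_ge0 hrho hJ hV bV Jx0.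
Let defectge0 := defect_ge0 hrho hJ hV bV Jx0.

Let margin_ge0 : 0 <= steering_margin.
Proof.
by apply: addr_ge0 => //; apply: addr_ge0; apply: mulr_ge0 => //; exact: addr_ge0.
Qed.

Lemma letter_choice : exists jf : G -> 'rV[R]_d -> seq 'I_m -> 'I_m,
  forall g S v, prefix u0 v ->
  dot S (word_sum (gw g) + l%:R *: fixpt (jf g S v) - (n + l)%:R *: tau v) <=
    - (steering_margin * norm1 S).
Proof.
have /choice[F hF] : forall q : G * 'rV[R]_d * seq 'I_m, exists j, prefix u0 q.2 ->
  dot q.1.2 (word_sum (gw q.1.1) + l%:R *: fixpt j - (n + l)%:R *: tau q.2) <=
    - (steering_margin * norm1 q.1.2).
  move=> [[g S] v] /=; have [h|h] := boolP (prefix u0 v).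
    by have [j hj] := steer g S h; exists j.
  by have [j hj] := steer g S (prefix_refl u0); exists j.
by exists (fun g S v => F (g, S, v)) => g S v; exact: (hF (g, S, v)).
Qed.

Section Construction.
Variable jf : G -> 'rV[R]_d -> seq 'I_m -> 'I_m.
Hypothesis hjf : forall g S v, prefix u0 v ->
  dot S (word_sum (gw g) + l%:R *: fixpt (jf g S v) - (n + l)%:R *: tau v) <=
    - (steering_margin * norm1 S).

Definition discrepancy (st : seq 'I_m * 'rV[R]_d) := word_sum st.1 - st.2.

Definition block (st : seq 'I_m * 'rV[R]_d) (g : G) : seq 'I_m :=
  gw g ++ nseq l (jf g (discrepancy st) st.1).

(* The choices are listed with the most recent one first; the second component
   accumulates the targets b tau(u_0) + ... + b tau(u_{k-1}). *)
Fixpoint rstate (rs : seq G) : seq 'I_m * 'rV[R]_d :=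
  if rs is g :: rs' then
    let st := rstate rs' in
    (st.1 ++ block st g ++ w0, st.2 + b%:R *: tau st.1)
  else (u0, 0).

Definition state s := rstate (rev s).

Lemma state_rcons s g : state (rcons s g) =
  ((state s).1 ++ block (state s) g ++ w0, (state s).2 + b%:R *: tau (state s).1).
Proof. by rewrite /state rev_rcons. Qed.

Lemma block_size s g : size (block s g) = (n + l)%N.
Proof. by rewrite size_cat gw_size size_nseq. Qed.

Lemma block_inj s : injective (block s).
Proof.
move=> g g' /(congr1 (take n)); rewrite /block.
by rewrite -{1}(gw_size g) take_size_cat// -{1}(gw_size g') take_size_cat// => /gw_inj.
Qed.

Lemma state_prefix s : prefix u0 (state s).1.
Proof.
elim/last_ind: s => [|s g IH]; first exact: prefix_refl.
by rewrite state_rcons /=; move: IH => /prefixP[v ->]; rewrite -catA prefix_prefix.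
Qed.

(** The step is the main term [p], which [hjf] pulls inwards with strength [steering_margin], plus
    errors [e1] to [e5] that use up all but 1 of it. *)
Lemma discrepancy_rcons s g : exists a,
  [/\ discrepancy (state (rcons s g)) = discrepancy (state s) + a,
      `|a| <= (n + l)%:R * (M + Mt) + steering_margin &
      dot (discrepancy (state s)) a <= - norm1 (discrepancy (state s))].
Proof.
set S := discrepancy (state s); set u := (state s).1; set t := tau u.
set j := jf g S u; set v := nseq l j.
set p := word_sum (gw g) + l%:R *: fixpt j - (n + l)%:R *: t.
set e1 := word_sum (u ++ (gw g ++ v) ++ w0) - (word_sum u + word_sum ((gw g ++ v) ++
  w0)).
set e2 := word_sum (gw g ++ (v ++ w0)) - (word_sum (gw g) + word_sum (v ++ w0)).
set e3 := word_sum (v ++ w0) - (word_sum v + word_sum w0).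
set e4 := word_sum v - l%:R *: fixpt j.
set e5 := word_sum w0 - (size w0)%:R *: t.
have he : `|e1 + e2 + e3 + e4 + e5| <= steering_margin - 1.
  have h1 : `|e1| <= defect by exact: (word_sum_cat hrho hJ hV bV Jx0).
  have h2 : `|e2| <= defect by exact: (word_sum_cat hrho hJ hV bV Jx0).
  have h3 : `|e3| <= defect by exact: (word_sum_cat hrho hJ hV bV Jx0).
  have h4 : `|e4| <= defect by exact: word_sum_nseq.
  have h5 : `|e5| <= (size w0)%:R * (M + Mt).
    apply: le_trans (ler_normB _ _) _; rewrite mulrDr lerD//.
      exact: (norm_word_sum hrho hJ hV bV Jx0).
    by rewrite normrZ normr_nat ler_wpM2l// tau_bound// state_prefix.
  have g1 := ler_normD (e1 + e2 + e3 + e4) e5.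
  have g2 := ler_normD (e1 + e2 + e3) e4.
  have g3 := ler_normD (e1 + e2) e3.
  have g4 := ler_normD e1 e2.
  rewrite /steering_margin; lra.
exists (p + (e1 + e2 + e3 + e4 + e5)); split.
- rewrite /discrepancy state_rcons /= /block -/S -/u -/j -/v -/t.
  rewrite /S /discrepancy -/u /p /e1 /e2 /e3 /e4 /e5 -!catA.
  apply/rowP => i; rewrite !mxE !natrD; ring.
- apply: le_trans (ler_normD _ _) _; apply: lerD; last first.
    by apply: le_trans he _; rewrite gerBl.
  apply: le_trans (ler_normB _ _) _; rewrite mulrDr lerD//; last first.
    by rewrite normrZ normr_nat ler_wpM2l// tau_bound// state_prefix.
  apply: le_trans (ler_normD _ _) _; rewrite natrD mulrDl lerD//.
    by have := norm_word_sum hrho hJ hV bV Jx0 (gw g); rewrite gw_size.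
  rewrite normrZ normr_nat ler_wpM2l//; apply: (attractor_bound hrho hJ hV bV).
  exact: (coding_attractor hrho hJ hV bV).
- rewrite dotDr; have h1 := hjf g S (state_prefix s).
  have h2 := dot_le_norm1 S (e1 + e2 + e3 + e4 + e5).
  have h3 := ler_wpM2l (norm1_ge0 S) he.
  rewrite -/u -/j -/t -/p in h1.
  apply: le_trans (lerD h1 (le_trans h2 h3)) _; lra.
Qed.

Let B := Order.max (dot (discrepancy (state [::])) (discrepancy (state [::])))
  (potential_bound d ((n + l)%:R * (M + Mt) + steering_margin)).

Lemma discrepancy_bound s : dot (discrepancy (state s)) (discrepancy (state s)) <= B.
Proof.
elim/last_ind: s => [|s g IH]; first by rewrite le_max lexx.
have [a [-> ha hS]] := discrepancy_rcons s g.
apply: potential_step ha hS _ IH; last by rewrite le_max lexx orbT.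
by apply: addr_ge0 => //; apply: mulr_ge0 => //; exact: addr_ge0.
Qed.

Variable i0 : 'I_m.
Let ubr := fun s => (state s).1.
Let wd := fun s g => block (state s) g.
Let y sg := branch ubr i0 sg.

Let ubr_rcons s g : ubr (rcons s g) = ubr s ++ wd s g ++ w0.
Proof. by rewrite /ubr state_rcons. Qed.

Let wd_size s g : size (wd s g) = (n + l)%N.
Proof. exact: block_size. Qed.

Let mkseq_y sg k : mkseq (y sg) (size (ubr (mkseq sg k))) = ubr (mkseq sg k).
Proof. exact: (@mkseq_branch _ w0 G wd (n + l) wd_size b_gt0 ubr ubr_rcons). Qed.

Let size_u s : size (ubr s) = (size u0 + size s * b)%N.
Proof. exact: (@u_size _ w0 G wd (n + l) wd_size ubr ubr_rcons). Qed.

Lemma branch_start sg : mkseq (y sg) (size u0) = u0.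
Proof. exact: (mkseq_y sg 0). Qed.

Lemma branch_recurrent sg N :
  exists2 k, (N <= k)%N & mkseq (shiftn k (y sg)) (size w0) = w0.
Proof.
have e := mkseq_y sg N.+1.
rewrite mkseqS ubr_rcons catA size_cat mkseq_shiftn in e.
move/eqP: e; rewrite eqseq_cat ?size_mkseq// => /andP[_ /eqP e].
exists (size (ubr (mkseq sg N) ++ wd (mkseq sg N) (sg N))) => //.
rewrite size_cat size_u size_mkseq wd_size (leq_trans (leq_pmulr N b_gt0))//.
exact: leq_trans (leq_addl _ _) (leq_addr _ _).
Qed.

Let r0 : 0 < rmax. Proof. by have /andP[] := rmax01 hrho. Qed.
Let r1 : rmax < 1. Proof. by have /andP[] := rmax01 hrho. Qed.

Let Ct_ge0 (sg : nat -> G) : 0 <= Ct.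
Proof.
have := le_trans (normr_ge0 _) (tau_beta (branch_start sg) (leqnn _)).
by rewrite pmulr_lge0// exprn_gt0.
Qed.

(** After k blocks at least k letters are known, so the k-th target is off by at most
    [Ct * rmax ^+ k]: a geometric series. *)
Lemma target_bound sg k : `|(state (mkseq sg k)).2 - (k * b)%:R *: beta (y sg)| <=
  b%:R * (Ct / (1 - rmax)).
Proof.
have r1' : 0 < 1 - rmax by rewrite subr_gt0.
suff h : `|(state (mkseq sg k)).2 - (k * b)%:R *: beta (y sg)| <=
  b%:R * (Ct * ((1 - rmax ^+ k) / (1 - rmax))).
  apply: le_trans h _; rewrite ler_wpM2l// ler_wpM2l ?(Ct_ge0 sg)//.
  by rewrite ler_pdivrMr// mulVf ?gt_eqF// gerBl exprn_ge0// ltW.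
elim: k => [|k IH].
  by rewrite mul0n scale0r /= subrr normr0 expr0 subrr mul0r !mulr0.
rewrite mkseqS state_rcons /= mulSnr (natrD _ (k * b)) scalerDl opprD addrACA -scalerBr.
apply: le_trans (ler_normD _ _) _.
have -> : (1 - rmax ^+ k.+1) / (1 - rmax) = (1 - rmax ^+ k) / (1 - rmax) + rmax ^+ k.
  by rewrite exprS; field; rewrite gt_eqF.
rewrite !mulrDr lerD// normrZ normr_nat ler_wpM2l//.
rewrite -/(ubr _) -(mkseq_y sg k).
apply: le_trans (tau_beta (branch_start sg) _) _.
  by rewrite size_u leq_addr.
rewrite ler_wpM2l ?(Ct_ge0 sg)// ler_wiXn2l ?(ltW r0) ?(ltW r1)//.
by rewrite size_u size_mkseq (leq_trans _ (leq_addl _ _))// leq_pmulr.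
Qed.

(** At block ends the drift splits into the gap between orbit sum and [word_sum], the discrepancy,
    and the error of the accumulated targets. The initial word and an incomplete block have bounded
    length and get the crude linear bound. *)
Lemma branch_drift sg : exists C, forall N, `|orbit_sum N (y sg) - N%:R *: beta (y
  sg)| <= C.
Proof.
set be := beta (y sg).
have B0 : 0 <= B.
  apply: le_trans _ (discrepancy_bound [::]).
  by apply: sumr_ge0 => i _; rewrite -expr2 sqr_ge0.
pose K1 := defect + (Num.sqrt B + b%:R * (Ct / (1 - rmax))).
exists (K1 + (size u0 + b)%:R * (M + `|be|)) => N.
have K10 : 0 <= K1.
  rewrite !addr_ge0 ?sqrtr_ge0// mulr_ge0// divr_ge0 ?(Ct_ge0 sg)//.
  by rewrite subr_ge0 ltW.
have crude k z : `|orbit_sum k z - k%:R *: be| <= k%:R * (M + `|be|).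
  apply: le_trans (ler_normB _ _) _; rewrite mulrDr lerD//.
    exact: (norm_orbit_sum hrho hJ hV bV).
  by rewrite normrZ normr_nat.
have Mb0 : 0 <= M + `|be| by rewrite addr_ge0.
have [Nu|uN] := leqP N (size u0).
  apply: le_trans (crude _ _) _.
  rewrite -[leLHS]add0r lerD// ler_wpM2r// ler_nat.
  by rewrite (leq_trans Nu)// leq_addr.
pose k := ((N - size u0) %/ b)%N; pose r := ((N - size u0) %% b)%N.
have NE : N = (size u0 + k * b + r)%N.
  by rewrite -addnA /k /r -divn_eq subnKC// ltnW.
have rb : (r <= b)%N by rewrite ltnW// ltn_mod.
have su : size (ubr (mkseq sg k)) = (size u0 + k * b)%N by rewrite size_u size_mkseq.
rewrite {1}NE orbit_sumD.
rewrite [X in `|X|](_ : _ = (orbit_sum (size u0 + k * b) (y sg) - word_sum (ubr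
  (mkseq sg k)))
  + (discrepancy (state (mkseq sg k)) + ((state (mkseq sg k)).2 - (k * b)%:R *: be))
  + (orbit_sum r (shiftn (size u0 + k * b) (y sg)) - (size u0 + r)%:R *: be));
    last first.
  rewrite NE /discrepancy -/(ubr _); apply/rowP => i; rewrite !mxE !natrD; ring.
apply: le_trans (ler_normD _ _) _; apply: lerD.
  apply: le_trans (ler_normD _ _) _; apply: lerD.
    rewrite -(mkseq_y sg k) su; exact: (orbit_word_sum hrho hJ hV bV Jx0).
  apply: le_trans (ler_normD _ _) _; apply: lerD; last exact: target_bound.
  by apply: norm_le_dot; rewrite ?sqrtr_ge0// sqr_sqrtr// discrepancy_bound.
rewrite natrD scalerDl opprD addrCA.
apply: le_trans (ler_normD _ _) _; rewrite natrD mulrDl lerD//.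
  by rewrite normrN normrZ normr_nat ler_wpM2l// lerDr.
by apply: le_trans (crude _ _) _; rewrite ler_wpM2r// ler_nat.
Qed.

Lemma branch_drift_set sg : drift_set w0 u0 beta (chi (y sg)).
Proof.
exists (y sg) => //; split; first exact: branch_start.
- exact: branch_recurrent.
- exact: branch_drift.
Qed.

(** Whatever letters the steering picks, the appended part has ratio at least a fixed power of
    [rmin], so the mass condition holds uniformly in the history. *)
Lemma branch_measure t : 0 <= t ->
  1 <= \sum_g (ratio (gw g) * rmin ^+ (l + size w0)) `^ t ->
  hausdorff_measure t [set chi (y sg) | sg in [set: nat -> G]] != 0%E.
Proof.
move=> t0 h.
apply: (moran_measure_neq0 hrho hJ hV bV kap0_gt0 hw0 (wd := wd) wd_size _ b_gt0) => //.
  by move=> s; exact: block_inj.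
move=> s; apply: le_trans h _; apply: ler_sum => g _.
have rm0 : 0 < rmin by have /andP[] := rmin01 hrho.
rewrite ge0_ler_powR ?nnegrE ?(ltW (ratio_gt0 hrho _))//.
  by rewrite mulr_ge0 ?(ltW (ratio_gt0 hrho _))// exprn_ge0// ltW.
rewrite /wd /block -catA ratio_cat ler_wpM2l ?(ltW (ratio_gt0 hrho _))//.
set v := nseq _ _ ++ w0; rewrite (_ : (l + size w0)%N = size v) ?ratio_ge//.
by rewrite /v size_cat size_nseq.
Qed.

End Construction.

Lemma steering_nonempty (g : G) : drift_set w0 u0 beta !=set0.
Proof.
have [jf hjf] := letter_choice.
have [i0 _] := steer g 0 (prefix_refl u0).
by eexists; exact: (branch_drift_set hjf i0 (fun _ => g)).
Qed.

Lemma steering_measure t : 0 <= t ->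
  1 <= \sum_g (ratio (gw g) * rmin ^+ (l + size w0)) `^ t ->
  hausdorff_measure t (drift_set w0 u0 beta) != 0%E.
Proof.
move=> t0 h; have [jf hjf] := letter_choice.
have [g _] : exists g : G, True.
  apply: contrapT => nG; move: h; rewrite big1 ?ler10// => g.
  by exfalso; apply: nG; exists g.
have [i0 _] := steer g 0 (prefix_refl u0).
apply/negP => /eqP H0; have := branch_measure jf i0 t0 h.
rewrite (hausdorff_measure0_sub _ H0) ?eqxx// => _ [sg _ <-].
exact: branch_drift_set.
Qed.

End Steering.

(** * Support functions of the attractor *)

Section Support.
Variables (R : realType) (d m : nat) (rho : 'I_m -> R) (c : 'I_m -> 'rV[R]_d).
Variables (J V : set 'rV[R]_d) (M : R).
Hypothesis hrho : forall j, 0 < rho j < 1.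
Hypothesis hJ : is_attractor (ifs rho c) J.
Hypothesis hV : sosc (ifs rho c) J V.
Hypothesis bV : forall p, V p -> `|p| <= M.
Local Notation f := (ifs rho c).
Local Notation fw := (word_map (ifs rho c)).
Local Notation ratio := (ratio rho).
Local Notation rmax := (rmax rho).
Local Notation rmin := (rmin rho).
Local Notation chi := (coding (ifs rho c) V).
Local Notation fixpt := (fixpt rho c V).
Implicit Types (S p q : 'rV[R]_d) (w : seq 'I_m) (y z : nat -> 'I_m).

Let r0 : 0 < rmax. Proof. by have /andP[] := rmax01 hrho. Qed.
Let r1 : rmax < 1. Proof. by have /andP[] := rmax01 hrho. Qed.

Lemma fixptE j : f j (fixpt j) = fixpt j.
Proof. by rewrite {2}/fixpt (coding_shift hrho hJ hV bV _ 1). Qed.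

Lemma fixpt_attractor j : J (fixpt j).
Proof. exact: (coding_attractor hrho hJ hV bV). Qed.

(** The supporting hyperplane in direction [S] passes through [fixpt j]; [height] below measures how
    far a point lies on its inner side. *)
Definition lowest S j := forall i, dot S (fixpt j) <= dot S (fixpt i).

Lemma lowest_ex S : exists j, lowest S j.
Proof.
have [i0] : exists j0 : 'I_m, True.
  by case: hJ => -[p +] _ e; rewrite e => -[j _ _]; exists j.
case: (arg_minP (fun j => dot S (fixpt j)) (isT : xpredT i0)) => j _ hj _.
by exists j => i; exact: hj.
Qed.

Definition height S j p := dot S p - dot S (fixpt j).

Lemma height_ifs S j i p : height S j (f i p) =
  rho i * height S j p + (1 - rho i) * height S j (fixpt i).
Proof.
have := fixptE i; rewrite /ifs => e.
have -> : c i = fixpt i - rho i *: fixpt i by rewrite -{1}e addrAC subrr add0r.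
by rewrite /height dotDr dotZr dotBr dotZr; ring.
Qed.

Lemma height_fw_ge S j w p : lowest S j ->
  ratio w * height S j p <= height S j (fw w p).
Proof.
move=> hj; elim: w => [|i w IH]; first by rewrite ratio_nil mul1r.
have /andP[i0 i1] := hrho i.
rewrite [fw _ _]/= height_ifs ratio_cons -mulrA -[leLHS]addr0 lerD//.
  by rewrite ler_wpM2l// ltW.
by rewrite mulr_ge0// ?subr_ge0 ?(ltW i1)//; exact: hj.
Qed.

Lemma height_fw_le S j w p (B : R) : (forall i, i \in w -> height S j (fixpt i) <= B) ->
  height S j (fw w p) - B <= ratio w * (height S j p - B).
Proof.
elim: w => [_|i w IH hB]; first by rewrite ratio_nil mul1r.
have /andP[i0 i1] := hrho i.
rewrite [fw _ _]/= height_ifs ratio_cons -mulrA.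
have h1 := IH (fun i' hi' => hB i' (mem_behead (s := i :: w) hi')).
have h2 := hB i (mem_head _ _).
apply: le_trans (ler_wpM2l (ltW i0) h1).
have : (1 - rho i) * height S j (fixpt i) <= (1 - rho i) * B.
  by rewrite ler_wpM2l// subr_ge0 ltW.
lra.
Qed.

Lemma limit_ge0 (a C : R) : (forall n, - (rmax ^+ n * C) <= a) -> 0 <= a.
Proof.
move=> h; rewrite leNgt; apply/negP => a0.
have := @expr_small _ rmax C (- a); rewrite (ltW r0) r1 oppr_gt0 => /(_ isT a0)[n].
by move=> /(_ n (leqnn n)); rewrite ltNge lerNl h.
Qed.

Let dotJ S p : J p -> `|dot S p| <= norm1 S * M.
Proof.
move=> Jp; apply: le_trans (dot_le _ _) _; rewrite ler_wpM2l ?norm1_ge0//.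
exact: (attractor_bound hrho hJ hV bV).
Qed.

Let heightJ S j p : J p -> `|height S j p| <= 2 * (norm1 S * M).
Proof.
move=> Jp; apply: le_trans (ler_normB _ _) _.
by rewrite mulr_natl mulr2n lerD// dotJ//; exact: fixpt_attractor.
Qed.

(** A cylinder map shrinks a negative height at least by its ratio, and heights on [J] are bounded;
    long prefixes of a code leave no room for a negative value. *)
Lemma height_ge0 S j p : lowest S j -> J p -> 0 <= height S j p.
Proof.
move=> hj Jp; have [y yp] := coding_surj hrho hJ hV bV Jp.
apply: (@limit_ge0 _ (2 * (norm1 S * M))) => n.
rewrite yp (coding_shift hrho hJ hV bV y n); apply: le_trans (height_fw_ge _ _ hj).
set q := chi _; have Jq : J q by exact: (coding_attractor hrho hJ hV bV).
have := heightJ S j Jq; rewrite ler_norml => /andP[hq _].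
apply: (@le_trans _ _ (- (ratio (mkseq y n) * (2 * (norm1 S * M))))).
  rewrite lerN2 ler_wpM2r//.
    exact: le_trans (normr_ge0 _) (heightJ S j Jq).
  by have := ratio_le hrho (mkseq y n); rewrite size_mkseq.
by rewrite -mulrN ler_wpM2l ?(ltW (ratio_gt0 hrho _)).
Qed.

Lemma height_coding_le S j y (B : R) : (forall n, height S j (fixpt (y n)) <= B) ->
  height S j (chi y) <= B.
Proof.
move=> hB; rewrite -subr_ge0; apply: (@limit_ge0 _ (`|B| + 2 * (norm1 S * M))) => n.
rewrite lerNl opprB {1}(coding_shift hrho hJ hV bV y n).
apply: le_trans (height_fw_le _ _) _.
  by move=> i /mapP[k _ ->].
set q := chi _; have Jq : J q by exact: (coding_attractor hrho hJ hV bV).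
apply: (@le_trans _ _ (ratio (mkseq y n) * (`|B| + 2 * (norm1 S * M)))).
  rewrite ler_wpM2l ?(ltW (ratio_gt0 hrho _))// addrC lerD//.
    by rewrite -normrN ler_norm.
  exact: le_trans (ler_norm _) (heightJ S j Jq).
rewrite ler_wpM2r ?addr_ge0//.
  exact: le_trans (normr_ge0 _) (heightJ S j Jq).
by have := ratio_le hrho (mkseq y n); rewrite size_mkseq.
Qed.

(* If chi z lies on a face of the hull, then all letters of z fix that face, and
   so does every tail of z: this is why its height controls that of the tails. *)
Lemma height_tail z : exists2 e : R, 0 < e & forall S j n, lowest S j ->
  e * height S j (chi (shiftn n z)) <= height S j (chi z).
Proof.
(* Each letter of [z] occurs at a position [k i]. As there are finitely many letters, the largest
   position gives an [e] independent of the direction and of the tail. *)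
have /choice[k hk] : forall i, exists k, (exists n, z n = i) -> z k = i.
  by move=> i; have [[n zn]|nz] := pselect (exists n, z n = i); [exists n|exists 0%N].
have [a0 a1] := andP (rmin01 hrho).
pose N := (\max_i k i)%N; pose e := rmin ^+ N * (1 - rmax).
have e0 : 0 < e by rewrite mulr_gt0 ?exprn_gt0// subr_gt0.
exists e => // S j n hj; rewrite mulrC -ler_pdivlMr//.
apply: height_coding_le => l; rewrite /shiftn.
set i := z _; rewrite ler_pdivlMr// mulrC.
have zk : z (k i) = i by apply: hk; exists (n + l)%N.
rewrite (coding_shift hrho hJ hV bV z (k i)); apply: le_trans (height_fw_ge _ _ hj).
rewrite (coding_shift hrho hJ hV bV _ 1) [fw _ _]/= height_ifs.
rewrite /shiftn addn0 zk -/(shiftn _ _).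
set q := chi _; have Jq : J q by exact: (coding_attractor hrho hJ hV bV).
have /andP[i0 i1] := hrho i.
have hi : 0 <= height S j (fixpt i) by rewrite height_ge0//; exact: fixpt_attractor.
apply: (@le_trans _ _ (ratio (mkseq z (k i)) * ((1 - rho i) * height S j (fixpt
  i)))); last first.
  by rewrite ler_wpM2l ?(ltW (ratio_gt0 hrho _))// lerDr mulr_ge0 ?(ltW i0)//
    height_ge0.
rewrite mulrA ler_wpM2r// /e ler_pM ?exprn_ge0 ?subr_ge0 ?(ltW r1) ?(ltW a0)//.
  apply: le_trans (ratio_ge hrho _); rewrite size_mkseq.
  by rewrite ler_wiXn2l ?(ltW a0) ?(ltW a1)// (@leq_bigmax _ k i).
by rewrite lerB// rmax_ge.
Qed.

(* Interior points of the hull, in terms of support functions. *)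
Definition core_point q := exists2 r : R, 0 < r &
  forall S j, lowest S j -> r * norm1 S <= height S j q.

(* [q] belongs to the interior of [(K p + hull) / (K + 1)], in terms of support
   functions: blocks averaging [p] can be corrected to average [q] by adding a
   proportion [1 / (K + 1)] of letters. *)
Definition reachable (p q : 'rV[R]_d) (K : nat) (eta : R) :=
  forall S j, lowest S j ->
  K%:R * height S j p <= K.+1%:R * (height S j q - eta * norm1 S).

(** Replacing the tail of [z] by [q] changes the height by the ratio times (height of [q] minus
    height of the tail). For large [N] the tail costs at most a share 1 / (K + 1) of the height of
    [chi z], by [height_tail]; the height of [q] provides [eta]. *)
Lemma reachable_attractor z q K : J q -> core_point q ->
  exists N, exists2 eta : R, 0 < eta & reachable (chi z) (fw (mkseq z N) q) K eta.
Proof.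
move=> Jq [r r0' hr]; have [e e0 he] := height_tail z.
have K0 : (0 : R) < K.+1%:R by [].
have [N /(_ N (leqnn N)) hN] :=
  @expr_small _ rmax K.+1%:R e (introT andP (conj (ltW r0) r1)) e0.
exists N, (ratio (mkseq z N) * r); first by rewrite mulr_gt0// ratio_gt0.
move=> S j hj.
have ht := he S j N hj.
have E : height S j (fw (mkseq z N) q) = height S j (chi z) +
    ratio (mkseq z N) * (height S j q - height S j (chi (shiftn N z))).
  rewrite (coding_shift hrho hJ hV bV z N).
  rewrite fwE (fwE _ _ _ (chi _)) /height !dotDr !dotZr; ring.
have w0 := ratio_gt0 hrho (mkseq z N).
have wr : ratio (mkseq z N) <= rmax ^+ N by have := ratio_le hrho (mkseq z N);
  rewrite size_mkseq.
have h1 : K.+1%:R * (ratio (mkseq z N) * height S j (chi (shiftn N z))) <= height S j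
  (chi z).
  apply: le_trans ht; rewrite mulrA ler_wpM2r//.
    by rewrite height_ge0//; exact: (coding_attractor hrho hJ hV bV).
  by rewrite mulrC; apply: le_trans (ltW hN); rewrite ler_wpM2r.
have h2 : ratio (mkseq z N) * (r * norm1 S) <= ratio (mkseq z N) * height S j q.
  by rewrite ler_wpM2l ?(ltW w0)// hr.
have h3 := ler_wpM2l (ltW K0) h2.
rewrite E -natr1 in h1 h3 *; lra.
Qed.

Lemma reachable_convex p q K : core_point q -> (forall S j, lowest S j ->
  0 <= height S j p) ->
  exists q', exists2 eta : R, 0 < eta & reachable p q' K eta.
Proof.
move=> [r r0' hr] hp; pose t : R := K.+1%:R^-1.
have K0 : (0 : R) < K.+1%:R by [].
have t0 : 0 < t by rewrite invr_gt0.
have tK : K.+1%:R * t = 1 by rewrite mulfV// gt_eqF.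
exists ((1 - t) *: p + t *: q), (t * r); first exact: mulr_gt0.
move=> S j hj.
have -> : height S j ((1 - t) *: p + t *: q) = (1 - t) * height S j p + t * height S
  j q.
  by rewrite /height dotDr !dotZr; ring.
have h := hr S j hj.
have -> : K.+1%:R * ((1 - t) * height S j p + t * height S j q - t * r * norm1 S) =
   (K.+1%:R - K.+1%:R * t) * height S j p + K.+1%:R * t * (height S j q - r * norm1 S).
  ring.
by rewrite tK mul1r -natr1 addrK lerDl subr_ge0.
Qed.

Lemma core_point_reachable0 q p : core_point q ->
  exists2 eta : R, 0 < eta & reachable p q 0 eta.
Proof.
move=> [r r0' hr]; exists r => // S j hj.
by rewrite mul0r mul1r subr_ge0 hr.
Qed.

End Support.

(** * Symbolic dimension of a level set *)

Lemma leq_half_quotient k n : (0 < k)%N -> (4 * k <= n)%N ->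
  (n <= 4 * k * (n %/ (2 * k)))%N.
Proof.
move=> k0 kn; have k2 : (0 < 2 * k)%N by rewrite muln_gt0.
apply: leq_trans (ltnW (ltn_ceil n k2)) _; set q := (n %/ _)%N.
have q2 : (2 <= q)%N by rewrite leq_divRL// mulnA.
apply: (@leq_trans (2 * q * (2 * k))).
  by apply: leq_mul => //; rewrite mul2n -addnn -addn1 leq_add2l; exact: leq_trans q2.
by rewrite mulnACA (mulnC q) mulnA.
Qed.

Section Core.
Variables (R : realType) (d m : nat) (rho : 'I_m -> R) (c : 'I_m -> 'rV[R]_d).
Variables (J V : set 'rV[R]_d) (M : R).
Hypothesis hrho : forall j, 0 < rho j < 1.
Hypothesis hJ : is_attractor (ifs rho c) J.
Hypothesis hV : sosc (ifs rho c) J V.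
Hypothesis bV : forall p, V p -> `|p| <= M.
Local Notation fw := (word_map (ifs rho c)).
Local Notation ratio := (ratio rho).
Local Notation rmax := (rmax rho).
Local Notation rmin := (rmin rho).
Local Notation chi := (coding (ifs rho c) V).
Local Notation fixpt := (fixpt rho c V).
Local Notation lowest := (lowest rho c V).
Local Notation height := (height rho c V).
Local Notation reachable := (reachable rho c V).
Local Notation Jt := (regular_attractor (ifs rho c) V J).
Local Notation gt := (induced_map (ifs rho c) V).
Local Notation level := (level_set Jt (additive_potential gt id)).
Variable x0 : 'rV[R]_d.
Hypothesis Jx0 : J x0.
Local Notation word_sum := (word_sum rho c x0).
Local Notation orbit_sum := (orbit_sum rho c V).
Implicit Types (S p q : 'rV[R]_d) (w u v : seq 'I_m) (y z : nat -> 'I_m).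

Let r0 : 0 < rmax. Proof. by have /andP[] := rmax01 hrho. Qed.
Let r1 : rmax < 1. Proof. by have /andP[] := rmax01 hrho. Qed.
Let a0 : 0 < rmin. Proof. by have /andP[] := rmin01 hrho. Qed.
Let a1 : rmin < 1. Proof. by have /andP[] := rmin01 hrho. Qed.

Definition near_average (p : 'rV[R]_d) (delta : R) (w : seq 'I_m) : bool :=
  `|word_sum w - (size w)%:R *: p| <= (size w)%:R * delta.

(* At infinitely many levels, the cylinders whose average is close to p carry an
   s-dimensional sum of at least 1: p has "symbolic dimension" at least s. *)
Definition rich (p : 'rV[R]_d) (s : R) := forall delta N, 0 < delta ->
  exists2 n, (N <= n)%N &
    1 <= \sum_(w : n.-tuple 'I_m | near_average p delta w) ratio w `^ s.

Lemma average_near y p : Jt (chi y) ->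
  (n%:R^-1 : R) *: (\sum_(0 <= k < n) iter k gt (chi y)) @[n --> \oo] --> p ->
  forall delta, 0 < delta -> exists N, forall n, (N <= n)%N ->
    near_average p delta (mkseq y n).
Proof.
move=> ry cvp delta d0.
have d2 : 0 < delta / 2 by rewrite divr_gt0.
have /cvgrPdist_lt/(_ _ d2)[N _ hN] := cvp.
pose C := defect rho M; have defect' : 0 <= C by exact: (defect_ge0 hrho hJ hV bV Jx0).
exists (maxn N (Num.bound (C / (delta / 2))).+1) => n.
rewrite geq_max => /andP[Nn bn].
have n0 : (0 < n%:R :> R) by rewrite ltr0n (leq_trans _ bn).
have := hN n Nn; rewrite (regular_orbit_sum hrho hJ hV bV)// => h1.
have h2 : `|orbit_sum n y - n%:R *: p| <= n%:R * (delta / 2).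
  have -> : orbit_sum n y - n%:R *: p = - n%:R *: (p - n%:R^-1 *: orbit_sum n y).
    by rewrite scalerBr scalerA mulNr mulfV ?gt_eqF// scaleN1r scaleNr opprK addrC.
  by rewrite normrZ normrN normr_nat ler_wpM2l// ltW.
have h3 := orbit_word_sum hrho hJ hV bV Jx0 n y; rewrite distrC in h3.
have h4 : C <= n%:R * (delta / 2).
  rewrite -ler_pdivrMr//; apply/ltW; apply: lt_le_trans (archi_boundP _) _.
    by rewrite divr_ge0// ltW.
  by rewrite ler_nat ltnW.
rewrite /near_average size_mkseq -(subrKA (orbit_sum n y)).
apply: le_trans (ler_normD _ _) _; apply: le_trans (lerD h3 h2) _.
by move: h4; rewrite -/C; lra.
Qed.

(** Otherwise, for some [delta], the sums at all large levels stay below 1. The words near the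
    average [p] cover the level set at arbitrarily large levels, so its dimension is at most [s]. *)
Lemma rich_of_dim p s : 0 <= s -> (s%:E < hausdorff_dim (level p))%E -> rich p s.
Proof.
move=> s0; rewrite ltNge => /negP hs delta N d0; apply: contrapT => nex.
apply: hs; apply: hausdorff_dim_le => // t st.
apply: (@limsup_cover_null _ _ _ _ c J M hrho (attractor_bound hrho hJ hV bV) _
  (near_average p delta) s t 1 N); rewrite ?s0//.
- move=> x [Jx cx] N'; have [y yx] := regular_surj hrho hJ hV bV Jx.
  rewrite yx in Jx cx *.
  have [N1 hN1] := average_near Jx cx d0.
  exists (mkseq y (maxn N1 N')); split; first by rewrite size_mkseq leq_maxr.
    by rewrite hN1// leq_maxl.
  by have [q Jq ->] := codingP hrho hJ hV bV y (maxn N1 N'); exists q.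
- move=> n Nn; rewrite leNgt; apply/negP => h; apply: nex; exists n => //.
  exact: ltW.
Qed.

(** Each point of [A] has its own tolerance and level with sums at most 1. Balls of half the
    tolerance have a finite subcover, and [L] is the number of balls used. *)
Lemma compact_sum_bound (A : set 'rV[R]_d) s : compact A -> (forall p, A p ->
  ~ rich p s) ->
  exists delta N L, 0 < delta /\ forall n, (N <= n)%N ->
    \sum_(w : n.-tuple 'I_m | `[< exists2 p, A p & near_average p delta w >])
      ratio w `^ s <= L.
Proof.
move=> cA hA.
have /choice[h hh] : forall p, exists h : R * nat, A p -> 0 < h.1 /\
    forall n, (h.2 <= n)%N ->
      \sum_(w : n.-tuple 'I_m | near_average p h.1 w) ratio w `^ s <= 1.
  move=> p; have [Ap|nAp] := pselect (A p); last by exists (1, 0%N).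
  apply: contrapT => nex; apply: (hA _ Ap) => delta N d0; apply: contrapT => nex'.
  apply: nex; exists (delta, N) => _; split => // n Nn /=.
  by rewrite leNgt; apply/negP => hgt; apply: nex'; exists n => //; exact: ltW.
move: cA; rewrite compact_cover => /(_ _ A (fun p => ball p ((h p).1 / 2))).
case=> [p Ap||D' D'A cov].
- by apply: ball_open; have [h0 _] := hh _ Ap; rewrite divr_gt0.
- move=> p Ap; exists p => //; apply: ballxx; have [h0 _] := hh _ Ap.
  by rewrite divr_gt0.
pose D := finmap.enum_fset D'.
have DA p : p \in D -> A p by move=> /D'A; rewrite inE.
pose delta := \big[Order.min/1]_(p <- D) ((h p).1 / 2).
exists delta, (\max_(p <- D) (h p).2)%N, (\sum_(p <- D) 1); split.
  rewrite /delta big_seq; apply: (big_ind (fun x => 0 < x)) => //.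
    by move=> a b a0' b0'; rewrite lt_min a0'.
  by move=> p /DA /hh[h0 _]; rewrite divr_gt0.
move=> n Nn.
apply: (@le_trans _ _ (\sum_(w : n.-tuple 'I_m) \sum_(p <- D | near_average p (h p).1
  w) ratio w `^ s)).
  rewrite big_mkcond; apply: ler_sum => w _; case: ifPn => [/asboolP[q Aq hq]|_];
    last first.
    by apply: sumr_ge0 => p _; exact: powR_ge0.
  have [p pD' bp] := cov _ Aq; have pD : p \in D by [].
  rewrite big_mkcond (big_rem p)//= ifT ?lerDl.
    by apply: sumr_ge0 => p' _; case: ifP => // _; exact: powR_ge0.
  rewrite /near_average -(subrKA ((size w)%:R *: q)).
  apply: le_trans (ler_normD _ _) _; rewrite -scalerBr normrZ normr_nat.
  rewrite (splitr (h p).1) mulrDr lerD//; last first.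
    by rewrite ler_wpM2l//; move: bp; rewrite -ball_normE /= distrC => /ltW.
  apply: le_trans hq _; rewrite ler_wpM2l//.
  exact: (@ge_bigmin_seq _ _ _ _ _ p xpredT).
rewrite (exchange_big_dep xpredT)//= big_seq [leRHS]big_seq; apply: ler_sum => p pD.
have [_ hp] := hh _ (DA _ pD); apply: hp; apply: leq_trans Nn.
by rewrite (big_rem p)//= leq_maxl.
Qed.

Variables (w0 : seq 'I_m) (kap0 : R).
Hypothesis kap0_gt0 : 0 < kap0.
Hypothesis hw0 : forall p q, J p -> `|fw w0 p - q| < kap0 -> V q.
Local Notation drift_set := (drift_set rho c V w0).
Local Notation margin Mt := (steering_margin rho M w0 Mt).

(** Reachability with [n <= K * l] gives an inward pull of (n + l) eta. The errors of the word and
    of the target, a quarter of [eta] each, consume at most half of it, and the other half exceeds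
    the margin. *)
Lemma reachable_steer (n l K : nat) p q (eta : R) Mt S w t j :
  0 < eta -> lowest S j -> 0 <= height S j p ->
  reachable p q K eta -> (n <= K * l)%N ->
    `|word_sum w - n%:R *: p| <= n%:R * (eta / 4) ->
  `|t - q| <= eta / 4 -> margin Mt <= (n + l)%:R * (eta / 2) ->
  dot S (word_sum w + l%:R *: fixpt j - (n + l)%:R *: t) <= - (margin Mt * norm1 S).
Proof.
move=> eta0 hj hp hr nKl hw ht hm.
have S0 := norm1_ge0 S.
have hr' := hr S j hj.
set X := height S j q - eta * norm1 S in hr'.
have hX : n%:R * height S j p <= (n + l)%:R * X.
  have K0 : (0 : R) < K.+1%:R by [].
  rewrite -(ler_pM2l K0) mulrCA [leRHS]mulrCA.
  apply: (@le_trans _ _ ((n + l)%:R * (K%:R * height S j p)));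
    last by rewrite ler_wpM2l.
  by rewrite !mulrA ler_wpM2r// -!natrM ler_nat mulnS mulnDl addnC leq_add2l mulnC.
have hB : dot S (word_sum w - n%:R *: p) <= norm1 S * (n%:R * (eta / 4)).
  by apply: le_trans (dot_le_norm1 _ _) _; rewrite ler_wpM2l.
have hT : - (norm1 S * (eta / 4)) <= dot S (t - q).
  by apply: le_trans (dot_ge_norm1 _ _); rewrite lerN2 ler_wpM2l.
have hT' := ler_wpM2l (ler0n R (n + l)) hT.
have hm' := ler_wpM2r S0 hm.
move: hB hT' hX; rewrite /X /height !dotBr dotDr !dotZr !natrD => hB hT' hX.
rewrite natrD in hm'.
have hl : 0 <= l%:R * (norm1 S * eta) by rewrite mulr_ge0// mulr_ge0// ltW.
lra.
Qed.

(** Two instances occur: [tracks_const] for level sets and [tracks_coding] for fixed averages. *)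
Definition tracks (u0 : seq 'I_m) (q : 'rV[R]_d) (eta : R) (tau : seq 'I_m -> 'rV[R]_d)
    (beta : (nat -> 'I_m) -> 'rV[R]_d) :=
  (forall v, prefix u0 v -> `|tau v - q| <= eta) /\
  exists C, forall y k, mkseq y (size u0) = u0 -> (size u0 <= k)%N ->
    `|tau (mkseq y k) - beta y| <= C * rmax ^+ k.

Lemma tracks_bound u0 q eta tau beta : tracks u0 q eta tau beta ->
  forall v, prefix u0 v -> `|tau v| <= `|q| + eta.
Proof.
move=> [h _] v /h hv; rewrite -(subrK q (tau v)) addrC.
by apply: le_trans (ler_normD _ _) _; rewrite lerD2l.
Qed.

(** Here [n = 0], [K = 0] and there is a single choice: steering letters alone produce one point,
    which is enough for density. *)
Lemma reachable_drift_set p q eta u0 tau beta : 0 < eta ->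
  (forall S j, lowest S j -> 0 <= height S j p) -> reachable p q 0 eta ->
  tracks u0 q (eta / 4) tau beta -> drift_set u0 beta !=set0.
Proof.
move=> eta0 hp hr ht; have [_ [Ct hCt]] := ht.
pose Mt := `|q| + eta / 4.
pose l := (Num.bound (`|margin Mt| / (eta / 2))).+1.
have hl : margin Mt <= (0 + l)%:R * (eta / 2).
  rewrite -ler_pdivrMr ?divr_gt0//; apply: le_trans (ler_norm _) _.
  rewrite normrM [X in _ * X]ger0_norm ?invr_ge0 ?divr_ge0 ?(ltW eta0)//.
  apply/ltW; apply: lt_le_trans (archi_boundP _) _.
    by rewrite divr_ge0 ?divr_ge0 ?(ltW eta0).
  by rewrite ler_nat.
apply: (@steering_nonempty _ _ _ _ _ _ _ _ hrho hJ hV bV _ Jx0 w0 unit 0 l (fun=>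
  [::]) _ _
  u0 tau Mt Ct beta (tracks_bound ht) hCt) => //.
move=> _ S v uv; have [j hj] := lowest_ex V hJ S; exists j.
apply: (reachable_steer eta0 hj (hp S j hj) hr) => //.
  by rewrite /= scale0r subrr normr0 mul0r.
by case: ht => /(_ v uv).
Qed.

(** [K] is fixed before [q], since the points reachable from [p] depend on it. The exponent lost
    between [s] and [t] pays for the steering letters and for [w0]. *)
Lemma rich_drift_dim p s t : 0 <= t < s -> rich p s ->
  (forall S j, lowest S j -> 0 <= height S j p) ->
  exists K, forall q eta u0 tau beta, 0 < eta -> reachable p q K eta ->
    tracks u0 q (eta / 4) tau beta -> (t%:E <= hausdorff_dim (drift_set u0 beta))%E.
Proof.
move=> /andP[t0 ts] hrich hp.
have st : 0 < s - t by rewrite subr_gt0.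
pose r := rmax `^ (s - t).
have r0' : 0 <= r by exact: powR_ge0.
have r1' : r < 1.
  rewrite [ltRHS](_ : 1 = 1 `^ (s - t)); last by rewrite powR1.
  by rewrite gt0_ltr_powR ?nnegrE// ltW.
(* With r^k at most rmin^t, the surplus exponent [s - t] on k letters of a rich word pays for one
   appended letter at exponent [t]. *)
have [k0 hk0] := @expr_small _ r 1 (rmin `^ t) (introT andP (conj r0' r1')) (powR_gt0
  _ a0).
pose k := k0.+1; have hk : r ^+ k <= rmin `^ t.
  by apply/ltW; have := hk0 k (leqnSn _); rewrite mulr1.
exists (4 * k)%N => q eta u0 tau beta eta0 hr ht; have [_ [Ct hCt]] := ht.
pose Mt := `|q| + eta / 4.
pose N1 := (Num.bound (`|margin Mt| / (eta / 2))).+1.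
have e4 : 0 < eta / 4 by rewrite divr_gt0.
have [n Nn hn] := hrich (eta / 4) (maxn N1 (maxn (4 * k) (2 * k * size w0)))%N e4.
move: Nn; rewrite !geq_max => /and3P[N1n kn wn].
(* Large enough for [n <= 4 * k * l], as steering with this [K] demands, and small enough for
   [k * (l + size w0) <= n], as the dimension demands. *)
pose l := (n %/ (2 * k))%N.
have nl : (n <= 4 * k * l)%N.
  exact: leq_half_quotient.
have lw : (k * (l + size w0) <= n)%N.
  rewrite -(leq_pmul2l (isT : 0 < 2)%N) mulnA mulnDr [leqRHS]mul2n -addnn leq_add//.
  by rewrite mulnC leq_trunc_div.
have hl : margin Mt <= (n + l)%:R * (eta / 2).
  rewrite -ler_pdivrMr ?divr_gt0//; apply: le_trans (ler_norm _) _.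
  rewrite normrM [X in _ * X]ger0_norm ?invr_ge0 ?divr_ge0 ?(ltW eta0)//.
  apply/ltW; apply: lt_le_trans (archi_boundP _) _.
    by rewrite divr_ge0 ?divr_ge0 ?(ltW eta0).
  by rewrite ler_nat; apply: leq_trans (leqnSn _) (leq_trans N1n (leq_addr _ _)).
pose A : {pred n.-tuple 'I_m} := [pred w | near_average p (eta / 4) (val w)].
pose gw (g : 'I_#|A|) : seq 'I_m := val (enum_val g).
have gws g : size (gw g) = n by rewrite size_tuple.
have gwi : injective gw by move=> g g' /val_inj/enum_val_inj.
have b0 : (0 < n + l + size w0)%N
  by rewrite -addnA addn_gt0 (leq_trans _ kn)// muln_gt0.
apply: hausdorff_dim_ge => t' /andP[t'0 t't].
apply: (@steering_measure _ _ _ _ _ _ _ _ hrho hJ hV bV _ Jx0 w0 kap0 kap0_gt0 hw0 _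
  n l gw gws gwi b0
  u0 tau Mt Ct beta (tracks_bound ht) hCt) => //.
  move=> g S v uv; have [j hj] := lowest_ex V hJ S; exists j.
  apply: (reachable_steer eta0 hj (hp S j hj) hr nl) => //.
    by have := enum_valP g; rewrite unfold_in /= /near_average size_tuple /gw.
  by case: ht => /(_ v uv).
apply: le_trans hn _.
have -> : \sum_(w : n.-tuple 'I_m | near_average p (eta / 4) w) ratio w `^ s =
    \sum_(w in A) ratio w `^ s by apply: eq_bigl => w; rewrite unfold_in.
rewrite big_enum_val; apply: ler_sum => g _.
rewrite -/(gw g); set x := ratio (gw g).
have x0' : 0 < x by exact: ratio_gt0.
have xr : x <= rmax ^+ n by have := ratio_le hrho (gw g); rewrite gws.
set L := (l + size w0)%N in lw *.
have y0 : 0 < rmin ^+ L by rewrite exprn_gt0.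
apply: (@le_trans _ _ ((x * rmin ^+ L) `^ t)); last first.
  apply: ger_powR (ltW t't); rewrite mulr_gt0//=.
  rewrite mulr_ile1 ?(ltW x0') ?(ltW y0)//.
    by apply: le_trans xr _; rewrite exprn_ile1// ltW.
  by rewrite exprn_ile1// ltW.
rewrite powRM ?(ltW x0') ?(ltW y0)// -{1}(subrK t s) addrC powRD; last first.
  by rewrite (gt_eqF x0') implybT.
rewrite ler_wpM2l ?powR_ge0//.
apply: (@le_trans _ _ (r ^+ n)).
  rewrite /r -powR_mulrn ?powR_ge0// -powRrM mulrC powRrM powR_mulrn ?(ltW r0)//.
  by rewrite ge0_ler_powR ?nnegrE ?exprn_ge0 ?(ltW x0') ?(ltW r0) ?(ltW st).
apply: (@le_trans _ _ (r ^+ (k * L))); first by rewrite ler_wiXn2l ?(ltW r1').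
rewrite exprM -(powR_mulrn L (ltW a0)) -powRrM mulrC powRrM powR_mulrn ?powR_ge0//.
by rewrite lerXn2r ?nnegrE ?exprn_ge0 ?powR_ge0.
Qed.

End Core.

(** * The convex hull of the attractor *)

Section ConvexHull.
Variables (R : realType) (d : nat).
Implicit Types (A C : set 'rV[R]_d) (x y p q : 'rV[R]_d).

Lemma convex_setE C : (forall x y (t : R), 0 <= t <= 1 -> C x -> C y ->
  C (t *: x + (1 - t) *: y)) <-> convex_set C.
Proof.
split=> [h x y l|h x y t /andP[t0 t1] Cx Cy].
  rewrite !inE => Cx Cy; rewrite /conv /=; apply: h => //.
  by apply/andP; split.
have := h x y (Itv01 t0 t1); rewrite !inE => /(_ Cx Cy).
by rewrite /conv /=.
Qed.

Lemma convex_hull_conv A x y (t : R) : 0 <= t <= 1 ->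
  convex_hull A x -> convex_hull A y -> convex_hull A (t *: x + (1 - t) *: y).
Proof.
by move=> t01 hx hy C [cC AC]; apply: ((convex_setE C).2 cC) => //;
  [apply: hx|apply: hy].
Qed.

Lemma sub_convex_hull A : A `<=` convex_hull A.
Proof. by move=> x Ax C [_]; apply. Qed.

Lemma convex_hull_min A C : (forall x y (t : R), 0 <= t <= 1 -> C x -> C y ->
  C (t *: x + (1 - t) *: y)) -> A `<=` C -> convex_hull A `<=` C.
Proof. by move=> h AC x; apply; split=> //; apply/convex_setE. Qed.

Lemma convex_hull_bound A (M : R) : (forall p, A p -> `|p| <= M) ->
  forall p, convex_hull A p -> `|p| <= M.
Proof.
move=> h; apply: convex_hull_min => // x y t /andP[t0 t1] hx hy.
apply: le_trans (ler_normD _ _) _; rewrite !normrZ (ger0_norm t0) ger0_norm ?subr_ge0//.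
have -> : M = t * M + (1 - t) * M by ring.
by rewrite lerD// ler_wpM2l// subr_ge0.
Qed.

Lemma convex_hull_sum A (I : eqType) (s : seq I) (nu : I -> R) (P : I -> 'rV[R]_d) :
  (forall i, 0 <= nu i) -> (forall i, convex_hull A (P i)) -> \sum_(i <- s) nu i = 1 ->
  convex_hull A (\sum_(i <- s) nu i *: P i).
Proof.
move=> nu0 AP s1.
(* The weights of a tail of [s] no longer sum to 1, so the induction runs on normalised sums. *)
suff h : 0 < \sum_(i <- s) nu i ->
    convex_hull A ((\sum_(i <- s) nu i)^-1 *: (\sum_(i <- s) nu i *: P i)).
  by move: h; rewrite s1 invr1 scale1r; apply.
elim: s {s1} => [|i s IH]; first by rewrite big_nil ltxx.
rewrite !big_cons; set a := \sum_(i <- s) nu i; set v := \sum_(i <- s) _.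
have a0 : 0 <= a by exact: sumr_ge0.
move=> ia0; have [a00|an0] := eqVneq a 0.
  have -> : v = 0.
    rewrite /v big_seq big1 // => k ks.
    move: a00 => /eqP; rewrite psumr_eq0// => /allP/(_ _ ks)/eqP ->.
    by rewrite scale0r.
  rewrite a00 !addr0 scalerA mulVf ?scale1r//.
  by move: ia0; rewrite a00 addr0 => /lt0r_neq0.
have {}a0 : 0 < a by rewrite lt0r an0.
have := convex_hull_conv (t := nu i / (nu i + a)) _ (AP i) (IH a0).
have -> : 0 <= nu i / (nu i + a) <= 1.
  by rewrite divr_ge0 ?(ltW ia0)//= ler_pdivrMr// mul1r lerDl ltW.
move=> /(_ isT); congr (convex_hull A _).
rewrite scalerDr !scalerA; congr (_ + _); first by rewrite mulrC.
rewrite -/a -/v; congr (_ *: _); field.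
by rewrite (gt_eqF ia0) (gt_eqF a0).
Qed.

End ConvexHull.

(** * Fixed points of words and the interior of the hull *)

Section HullInterior.
Variables (R : realType) (d m : nat) (rho : 'I_m -> R) (c : 'I_m -> 'rV[R]_d).
Variables (J : set 'rV[R]_d).
Hypothesis hrho : forall j, 0 < rho j < 1.
Hypothesis hJ : is_attractor (ifs rho c) J.
Local Notation f := (ifs rho c).
Local Notation fw := (word_map (ifs rho c)).
Local Notation ratio := (ratio rho).
Local Notation rmax := (rmax rho).
Local Notation H := (convex_hull J).

Lemma ratio_lt1 w : w != [::] -> ratio w < 1.
Proof.
have [r0 r1] := andP (rmax01 hrho).
case: w => // j w _; apply: le_lt_trans (ratio_le hrho _) _.
by rewrite exprn_ilt1 ?(ltW r0).
Qed.

(* The junk value of the inverse is only met at the empty word. *)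
Definition word_fixpt w : 'rV[R]_d := (1 - ratio w)^-1 *: fw w 0.

Lemma word_fixptE w : w != [::] -> fw w (word_fixpt w) = word_fixpt w.
Proof.
move=> wn; have w1 : 1 - ratio w != 0 by rewrite gt_eqF// subr_gt0 ratio_lt1.
rewrite fwE /word_fixpt scalerA -[X in _ + X]scale1r -scalerDl; congr (_ *: _).
by field.
Qed.

(** Iterating [fw w] from a point of [J] stays in [J] and converges to the fixed point; [J] is
    closed. *)
Lemma word_fixpt_attractor w : w != [::] -> J (word_fixpt w).
Proof.
move=> wn; have [[x0 Jx0] cJ _] := hJ.
have clJ : closed J by apply: compact_closed => //; exact: norm_hausdorff.
set p := word_fixpt w.
have E n : iter n (fw w) x0 - p = ratio w ^+ n *: (x0 - p).
  elim: n => [|n IH]; first by rewrite expr0 scale1r.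
  by rewrite iterS -{1}(word_fixptE wn : fw w p = p) fwB IH scalerA exprS.
have Jn n : J (iter n (fw w) x0) by elim: n => [//|n IH] /=; exact: fw_attractor.
rewrite (closure_id J).1// => B /nbhs_ballP[e /= e0 eB].
have w01 : 0 <= ratio w < 1 by rewrite (ltW (ratio_gt0 hrho w)) ratio_lt1.
have [n /(_ n (leqnn n)) hn] := expr_small (`|x0 - p|) w01 e0.
exists (iter n (fw w) x0); split => //; apply: eB; rewrite -ball_normE /= distrC E.
by rewrite normrZ ger0_norm// exprn_ge0// ltW// ratio_gt0.
Qed.

Let p_ j := word_fixpt [:: j].

Let fixE j x : f j x = rho j *: x + (1 - rho j) *: p_ j.
Proof.
have := word_fixptE (isT : [:: j] != [::]); rewrite -/(p_ j) /= /ifs => e.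
have -> : c j = p_ j - rho j *: p_ j by rewrite -{1}e addrAC subrr add0r.
by rewrite scalerBl scale1r.
Qed.

Lemma fw_weights w : exists lam : 'I_m -> R, [/\ forall j, 0 <= lam j,
  forall j, j \in w -> 0 < lam j, \sum_j lam j = 1 - ratio w &
  forall x, fw w x = ratio w *: x + \sum_j lam j *: p_ j].
Proof.
elim: w => [|i w [lam [l0 lw ls lx]]].
  exists (fun=> 0); split => //; first by rewrite ratio_nil subrr big1.
  by move=> x; rewrite ratio_nil scale1r big1 ?addr0// => j _; rewrite scale0r.
have /andP[i0 i1] := hrho i.
exists (fun j => rho i * lam j + (1 - rho i) * (j == i)%:R); split.
- by move=> j; rewrite addr_ge0 ?mulr_ge0 ?subr_ge0 ?(ltW i0) ?(ltW i1).
- move=> j; rewrite inE; case: eqP => [_ _|_ /= jw].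
    by rewrite mulr1 ltr_wpDl ?subr_gt0// mulr_ge0// ltW.
  by rewrite mulr0 addr0 mulr_gt0// lw.
- rewrite big_split /= -!mulr_sumr ls ratio_cons.
  rewrite (bigD1 i)//= eqxx mulr1n big1 ?addr0 => [|j /negbTE->//]; ring.
- move=> x; rewrite [fw _ _]/= fixE lx ratio_cons scalerDr scalerA -addrA;
  congr (_ + _).
  rewrite scaler_sumr.
  rewrite [RHS](eq_bigr (fun j => rho i *: (lam j *: p_ j) + ((1 - rho i) * (j ==
    i)%:R) *: p_ j)).
    rewrite big_split /=; congr (_ + _).
    rewrite (bigD1 i)//= eqxx mulr1 big1 ?addr0// => j /negbTE->.
    by rewrite mulr0 scale0r.
  by move=> j _; rewrite scalerDl scalerA.
Qed.

Lemma hull_ifs j x : H x -> H (f j x).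
Proof.
move: x; apply: convex_hull_min => [x y t t01 hx hy|x Jx].
  have -> : f j (t *: x + (1 - t) *: y) = t *: f j x + (1 - t) *: f j y.
    apply/rowP => i; rewrite /ifs !mxE; ring.
  exact: convex_hull_conv.
by apply: sub_convex_hull; exact: (fw_attractor hJ [:: j]).
Qed.

Lemma interior_hull_ifs j x : interior H x -> interior H (f j x).
Proof.
move=> Hx; have o : open (fw [:: j] @` interior H).
  by apply: fw_image_open => //; exact: open_interior.
suff s : fw [:: j] @` interior H `<=` interior H by apply: s; exists x.
rewrite -open_subsetE// => _ [y Hy <-];
  exact: (@hull_ifs j y (@interior_subset _ H y Hy)).
Qed.

Section FullDimension.
Hypothesis hdim : has_affine_dim H d.
Variable j0 : 'I_m.

(** The rows of [A] span the directions between fixed points; a vector lies in this span exactly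
    when the cokernel [K] kills it. *)
Let A : 'M[R]_(m, d) := \matrix_(j, i) (p_ j - p_ j0) ord0 i.
Let K := cokermx A.

Let kill_A j : (p_ j - p_ j0) *m K = 0.
Proof.
have -> : p_ j - p_ j0 = row j A by apply/rowP => i; rewrite !mxE.
by rewrite -row_mul mulmx_coker row0.
Qed.

(* Modulo the span of the p_j - p_{j0}, the maps f_j are pure contractions with
   the same fixed point, so the attractor collapses to that point. *)
Let kill_J x : J x -> (x - p_ j0) *m K = 0.
Proof.
move=> Jx; have [y hy] := attractor_code hJ Jx.
have [_ cJ _] := hJ; have [C [_ hC]] := compact_bounded cJ.
have bJ q : J q -> `|q| <= C + 1 by apply: hC; rewrite ltrDl.
have W w q : (fw w q - p_ j0) *m K = ratio w *: ((q - p_ j0) *m K).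
  elim: w => [|i w IH]; first by rewrite ratio_nil scale1r.
  rewrite [fw _ _]/= fixE ratio_cons -scalerA -IH.
  have -> : rho i *: fw w q + (1 - rho i) *: p_ i - p_ j0 =
      rho i *: (fw w q - p_ j0) + (1 - rho i) *: (p_ i - p_ j0).
    apply/rowP => k; rewrite !mxE; ring.
  by rewrite mulmxDl -!scalemxAl kill_A scaler0 addr0.
pose D := \sum_i \sum_k `|K i k|.
apply/rowP => k; rewrite [RHS]mxE.
have hb (v : 'rV[R]_d) : `|(v *m K) ord0 k| <= `|v| * D.
  rewrite mxE; apply: le_trans (ler_norm_sum _ _ _) _; rewrite mulr_sumr.
  apply: ler_sum => i _; rewrite normrM ler_pM ?coord_le_norm//.
  by rewrite (bigD1 k)//= lerDl sumr_ge0.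
apply/eqP; rewrite -normr_le0; apply/ler_addgt0Pr => e e0; rewrite add0r.
have r01 : 0 <= rmax < 1 by have /andP[/ltW -> ->] := rmax01 hrho.
have [n /(_ n (leqnn n)) hn] := expr_small ((C + 1 + `|p_ j0|) * D) r01 e0.
have [q Jq ->] := hy n; rewrite W mxE normrM.
apply: le_trans (ltW hn); rewrite gtr0_norm ?ratio_gt0// ler_pM ?(ltW (ratio_gt0 hrho
  _))//.
  by have := ratio_le hrho (mkseq y n); rewrite size_mkseq.
apply: le_trans (hb _) _; rewrite ler_wpM2r//.
  by apply: sumr_ge0 => i _; exact: sumr_ge0.
by apply: le_trans (ler_normB _ _) _; rewrite lerD2r bJ.
Qed.

(** Differences of points of the hull are killed by [K]; since the hull has affine dimension d, they
    span the whole space. *)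
Let kill_all (v : 'rV[R]_d) : v *m K = 0.
Proof.
have [x0 [Hx0 [U [_ Umin dU]]]] := hdim.
have kH x : H x -> (x - p_ j0) *m K = 0.
  move: x; apply: convex_hull_min => [x y t t01 hx hy|x]; last exact: kill_J.
  have -> : t *: x + (1 - t) *: y - p_ j0 = t *: (x - p_ j0) + (1 - t) *: (y - p_ j0).
    apply/rowP => k; rewrite !mxE; ring.
  by rewrite mulmxDl -!scalemxAl hx hy !scaler0 addr0.
pose U' := lker (linfun (mulmxr K) : 'Hom('rV[R]_d, 'rV[R]_d)).
have UU' : (U <= U')%VS.
  apply: Umin => x Hx; rewrite memv_ker lfunE /=.
  rewrite (_ : x - x0 = (x - p_ j0) - (x0 - p_ j0)); last first.
    by rewrite opprB addrA subrK.
  by rewrite mulmxBl !kH// subrr.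
have UT : U = fullv.
  apply/eqP; rewrite eqEdim subvf dU dimvf /=.
  by rewrite /dim /= mul1n.
have : v \in U' by apply: (subvP UU'); rewrite UT memvf.
by rewrite memv_ker lfunE /= => /eqP.
Qed.

(** A word using every letter has as fixed point a mean of all [p_ j] with positive weights. As the
    [p_ k - p_ j0] span the space, a small displacement only perturbs the weights, which remain
    nonnegative. *)
Lemma center_interior : interior H (word_fixpt (enum 'I_m)).
Proof.
set w := enum 'I_m; set q := word_fixpt w.
have wn : w != [::] by apply/eqP => e; have := mem_enum 'I_m j0; rewrite -/w e.
have [lam [_ lw ls lx]] := fw_weights w.
have w1 : 0 < 1 - ratio w by rewrite subr_gt0 ratio_lt1.
pose mu j := lam j / (1 - ratio w).
have mu0 j : 0 < mu j by rewrite divr_gt0// lw// mem_enum.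
have mu1 : \sum_j mu j = 1 by rewrite -mulr_suml ls mulfV// gt_eqF.
have qE : q = \sum_j mu j *: p_ j.
  have e : (1 - ratio w) *: q = \sum_j lam j *: p_ j.
    by rewrite scalerBl scale1r -{1}(word_fixptE wn : fw w q = q) lx addrAC subrr add0r.
  rewrite -[LHS]scale1r -(mulVf (lt0r_neq0 w1)) -scalerA e scaler_sumr.
  by apply: eq_bigr => j _; rewrite scalerA mulrC.
pose P := pinvmx A; pose B := \sum_i \sum_k `|P i k|.
have B0 : 0 <= B by apply: sumr_ge0 => i _; exact: sumr_ge0.
pose mm := \big[Order.min/1]_j mu j.
have mm0 : 0 < mm by apply: lt_bigmin.
have mB : 0 < (m.+1)%:R * (B + 1) by rewrite mulr_gt0// ltr_wpDl.
apply/nbhs_ballP; exists (mm / ((m.+1)%:R * (B + 1))); first by rewrite /= divr_gt0.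
move=> x; rewrite -ball_normE /= distrC => hx; set v := x - q.
pose b := v *m P.
have bB k : `|b ord0 k| <= `|v| * B.
  rewrite mxE; apply: le_trans (ler_norm_sum _ _ _) _; rewrite mulr_sumr.
  apply: ler_sum => i _; rewrite normrM ler_pM ?coord_le_norm//.
  by rewrite (bigD1 k)//= lerDl sumr_ge0.
have vE : v = \sum_k b ord0 k *: (p_ k - p_ j0).
  have vA : (v <= A)%MS by rewrite submxE -/K kill_all.
  rewrite -{1}(mulmxKpV vA) mulmx_sum_row; apply: eq_bigr => k _; congr (_ *: _).
  by apply/rowP => i; rewrite !mxE.
(* The correction at [j0] restores the total weight 1. *)
pose nu k := mu k + b ord0 k - (k == j0)%:R * \sum_i b ord0 i.
have -> : x = \sum_k nu k *: p_ k.
  rewrite -(subrK q x) -/v {1}vE qE -big_split /=.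
  under [LHS]eq_bigr do rewrite scalerBr.
  under [RHS]eq_bigr do rewrite scalerBl scalerDl.
  rewrite big_split /= sumrB [RHS]sumrB big_split /= addrAC [in RHS](addrC (\sum_i _)).
  congr (_ + _ - _).
  rewrite -scaler_suml [RHS](bigD1 j0)//= eqxx mul1r [X in _ + X]big1 ?addr0//.
  by move=> k /negbTE->; rewrite mul0r scale0r.
apply: convex_hull_sum.
- move=> k; rewrite /nu.
  have hs : `|\sum_i b ord0 i| <= m%:R * (`|v| * B).
    apply: le_trans (ler_norm_sum _ _ _) _.
    apply: (@le_trans _ _ (\sum_(i < m) `|v| * B)); first exact: ler_sum.
    by rewrite sumr_const card_ord mulr_natl.
  have hk := bB k; have hmu : mm <= mu k by exact: bigmin_le.
  have hv : (m.+1)%:R * (`|v| * B) <= mm.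
    move: hx; rewrite -/v ltr_pdivlMr// => /ltW; apply: le_trans.
    by rewrite mulrCA ler_wpM2l// ler_wpM2l// lerDl.
  rewrite -natr1 in hv; move: hk hs; rewrite !ler_norml => /andP[hk _] /andP[hs1 hs2].
  have v0 : 0 <= `|v| * B by rewrite mulr_ge0.
  have mv0 : 0 <= m%:R * (`|v| * B) by rewrite mulr_ge0.
  by case: (k == j0); rewrite ?mul1r ?mul0r; lra.
- by move=> k; apply: sub_convex_hull; exact: word_fixpt_attractor.
- rewrite sumrB big_split /= mu1 [X in _ - X](bigD1 j0)//= eqxx mul1r.
  rewrite [X in _ - (_ + X)]big1 ?addr0 ?addrK//.
  by move=> k /negbTE->; rewrite mul0r.
Qed.

End FullDimension.

End HullInterior.

(** * The spectrum and the fixed points of the averages *)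

(** Two reals are provided because richness at [s] is turned into a dimension bound only for
    [t < s]. *)
Lemma ereal_between (R : realType) (x y : \bar R) : (0 <= x)%E -> (x < y)%E ->
  exists t s : R, [/\ 0 <= t < s, (x < t%:E)%E & (s%:E < y)%E].
Proof.
case: x => [x| |]; last 2 first.
- by move=> _; rewrite ltNge leey.
- by rewrite leeNy_eq.
rewrite lee_fin => x0; case: y => [y| |] xy; last by [].
  rewrite lte_fin in xy; exists (x + (y - x) / 3), (x + (y - x) * 2 / 3).
  by rewrite !lte_fin; split; [apply/andP; split|..]; lra.
by exists (x + 1), (x + 2); rewrite lte_fin ltry; split => //; [apply/andP; split|];
  lra.
Qed.

Lemma hausdorff_dim_set0 (R : realType) (d : nat) :
  (hausdorff_dim (set0 : set 'rV[R]_d) <= 0)%E.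
Proof.
apply: hausdorff_dim_le => // t _; apply: hausdorff_measure_eq0 => delta e d0 e0.
exists (fun=> set0); split => //.
  by move=> _; apply: ediam_le.
rewrite eseries0 ?lee_fin ?(ltW e0)// => i _ _.
by rewrite /hausdorff_gauge eqxx.
Qed.

Section Spectrum.
Variables (R : realType) (d m : nat) (rho : 'I_m -> R) (c : 'I_m -> 'rV[R]_d).
Variables (J V : set 'rV[R]_d) (M : R).
Hypothesis hrho : forall j, 0 < rho j < 1.
Hypothesis hJ : is_attractor (ifs rho c) J.
Hypothesis hV : sosc (ifs rho c) J V.
Hypothesis bV : forall p, V p -> `|p| <= M.
Local Notation fw := (word_map (ifs rho c)).
Local Notation ratio := (ratio rho).
Local Notation rmax := (rmax rho).
Local Notation chi := (coding (ifs rho c) V).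
Local Notation fixpt := (fixpt rho c V).
Local Notation lowest := (lowest rho c V).
Local Notation height := (height rho c V).
Local Notation core_point := (core_point rho c V).
Local Notation Jt := (regular_attractor (ifs rho c) V J).
Local Notation gt := (induced_map (ifs rho c) V).
Local Notation level := (level_set Jt (additive_potential gt id)).
Local Notation F := (fixed_average_set Jt gt).
Local Notation drift_set := (drift_set rho c V).
Implicit Types (S p q : 'rV[R]_d) (w u v : seq 'I_m) (y z : nat -> 'I_m).

Let chiJ := coding_attractor hrho hJ hV bV.
Let bJ := attractor_bound hrho hJ hV bV.

(** Moving [q] by e / 2 against the signs of [S] stays in the hull and lowers the height by (e / 2)
    [norm1 S], while heights on the hull are nonnegative. *)
Lemma core_point_interior q : interior (convex_hull J) q -> core_point q.
Proof.
move=> /nbhs_ballP[e /= e0 eH]; have e2 : 0 < e / 2 by rewrite divr_gt0.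
exists (e / 2) => // S j hj.
pose x := q - (e / 2) *: (\row_i Num.sg (S ord0 i)).
have Hx : convex_hull J x.
  apply: eH; rewrite -ball_normE /= /x opprB addrC subrK normrZ gtr0_norm//.
  apply: (@le_lt_trans _ _ (e / 2 * 1)); last by lra.
  by rewrite ler_wpM2l ?norm_sgr// ltW.
have : 0 <= height S j x.
  move: x Hx; apply: convex_hull_min => [a b t /andP[t0 t1] ha hb|p Jp].
    have -> : height S j (t *: a + (1 - t) *: b) = t * height S j a + (1 - t) *
      height S j b.
      by rewrite /height dotDr !dotZr; ring.
    by rewrite addr_ge0// mulr_ge0// subr_ge0.
  exact: (height_ge0 hrho hJ hV bV).
by rewrite /x /height dotBr dotZr dot_sgr; lra.
Qed.

Lemma core_point_fw w q : core_point q -> core_point (fw w q).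
Proof.
move=> [r r0 hr]; exists (ratio w * r); first by rewrite mulr_gt0// ratio_gt0.
move=> S j hj; rewrite -mulrA.
apply: le_trans (height_fw_ge hrho hJ hV bV w q hj).
by rewrite ler_wpM2l ?(ltW (ratio_gt0 hrho _))// hr.
Qed.

Variables (w0 : seq 'I_m) (kap0 : R).
Hypothesis kap0_gt0 : 0 < kap0.
Hypothesis hw0 : forall p q, J p -> `|fw w0 p - q| < kap0 -> V q.

Let JV0 p : J p -> V (fw w0 p).
Proof. by move=> Jp; apply: (hw0 Jp); rewrite subrr normr0. Qed.

Lemma drift_set_level q : drift_set w0 [::] (fun=> q) `<=` level q.
Proof.
move=> _ [y [_ rec [C hC]] <-].
have ry := regular_recurrent hrho hJ hV bV JV0 rec; split => //.
apply: (@bounded_drift_cvg _ _ (fun n => additive_potential gt id n (chi y)) _ C) => n.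
by rewrite /additive_potential (regular_orbit_sum hrho hJ hV bV).
Qed.

Lemma drift_set_fixed u0 : drift_set w0 u0 chi `<=` F.
Proof.
move=> _ [y [_ rec [C hC]] <-].
have ry := regular_recurrent hrho hJ hV bV JV0 rec; split => //.
apply: (@bounded_drift_cvg _ _ (fun n => \sum_(0 <= k < n) iter k gt (chi y)) _ C) => n.
by rewrite (regular_orbit_sum hrho hJ hV bV).
Qed.

Lemma tracks_const q (eta : R) : 0 <= eta -> tracks rho [::] q eta (fun=> q) (fun=> q).
Proof.
move=> e0; split => [v _|]; first by rewrite subrr normr0.
by exists 0 => y k _ _; rewrite subrr normr0 mul0r.
Qed.

Variable x0 : 'rV[R]_d.
Hypothesis Jx0 : J x0.
Variable xc : 'rV[R]_d.
Hypothesis Jxc : J xc.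
Hypothesis xc_core : core_point xc.

Lemma tracks_coding z N (eta : R) : 0 < eta -> exists v,
  tracks rho (mkseq z N ++ v) (fw (mkseq z N) xc) eta (fun w => fw w x0) chi.
Proof.
move=> eta0; have [zc ->] := coding_surj hrho hJ hV bV Jxc.
have r01 : 0 <= rmax < 1 by have /andP[/ltW -> ->] := rmax01 hrho.
have [n hn] := expr_small (2 * M) r01 eta0.
exists (mkseq zc n); split => [_ /prefixP[v ->]|].
  rewrite (coding_shift hrho hJ hV bV zc n) -fw_cat (fw_cat _ _ (_ ++ _)).
  have := fw_contract c hrho (mkseq z N ++ mkseq zc n) (bJ (fw_attractor hJ v Jx0))
    (bJ (chiJ (shiftn n zc))).
  move=> /le_trans; apply; apply/ltW/hn.
  by rewrite size_cat !size_mkseq leq_addl.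
exists (2 * M) => y k _ _; rewrite mulrC (coding_shift hrho hJ hV bV y k).
by have := fw_contract c hrho (mkseq y k) (bJ Jx0) (bJ (chiJ (shiftn k y)));
  rewrite size_mkseq.
Qed.

(** A drift set whose initial word extends a long prefix of a code of [x] lies close to [x]. *)
Lemma fixed_average_dense : J `<=` closure F.
Proof.
move=> x Jx B /nbhs_ballP[e /= e0 eB].
have [z xz] := coding_surj hrho hJ hV bV Jx.
have r01 : 0 <= rmax < 1 by have /andP[/ltW -> ->] := rmax01 hrho.
have [N /(_ N (leqnn N)) hN] := expr_small (2 * M) r01 e0.
have [eta eta0 hr] := core_point_reachable0 x0 (core_point_fw (mkseq z N) xc_core).
have e4 : 0 < eta / 4 by rewrite divr_gt0.
have [v hv] := tracks_coding z N e4.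
have [p Dp] := reachable_drift_set hrho hJ hV bV Jx0 w0 eta0
  (fun S j hj => height_ge0 hrho hJ hV bV hj Jx0) hr hv.
exists p; split; first exact: drift_set_fixed Dp.
have [y [yu _ _] <-] := Dp; apply: eB; rewrite -ball_normE /= xz.
apply: le_lt_trans hN; apply: (coding_agree hrho hJ hV bV).
move: yu; rewrite size_cat mkseq_shiftn size_mkseq => /eqP.
by rewrite eqseq_cat ?size_mkseq// => /andP[/eqP -> _].
Qed.

(** A large level set makes [p] rich. Steering blocks of average near [p] towards the point under
    construction, kept near a point reachable from [p], gives fixed averages of almost the same
    dimension. *)
Lemma fixed_average_dim_ge p : J p -> (hausdorff_dim (level p) <= hausdorff_dim F)%E.
Proof.
move=> Jp; rewrite leNgt; apply/negP => /ereal_between[|t [s [ts Ft sL]]].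
  exact: hausdorff_dim_ge0.
have s0 : 0 <= s by case/andP: ts => ? /ltW; exact: le_trans.
have hrich := rich_of_dim hrho hJ hV bV Jx0 s0 sL.
have [K hK] := rich_drift_dim hrho hJ hV bV Jx0 kap0_gt0 hw0 ts hrich
  (fun S j hj => height_ge0 hrho hJ hV bV hj Jp).
have [z pz] := coding_surj hrho hJ hV bV Jp.
have [N [eta eta0 hr]] := reachable_attractor hrho hJ hV bV z K Jxc xc_core.
rewrite -pz in hr.
have e4 : 0 < eta / 4 by rewrite divr_gt0.
have [v hv] := tracks_coding z N e4.
have := hK _ _ _ _ _ eta0 hr hv; apply/negP; rewrite -ltNge.
by apply: le_lt_trans Ft; apply: hausdorff_dim_sub; exact: drift_set_fixed.
Qed.

(** Were it false, no point of [J] would be s-rich, since a rich one makes the level set of a nearby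
    [q] in [J] too large. By compactness, words whose average is near some point of [J] have bounded
    sums, and they cover [F]. *)
Lemma fixed_average_dim_le :
  (hausdorff_dim F <= ereal_sup [set hausdorff_dim (level p) | p in J])%E.
Proof.
rewrite leNgt; apply/negP => /ereal_between[|t [s [ts St sF]]].
  apply: (@le_trans _ _ (hausdorff_dim (level x0))); first exact: hausdorff_dim_ge0.
  by apply: ereal_sup_ubound; exists x0.
have s0 : 0 <= s by case/andP: ts => ? /ltW; exact: le_trans.
have nr p : J p -> ~ rich rho c x0 p s.
  move=> Jp hrich.
  have [K hK] := rich_drift_dim hrho hJ hV bV Jx0 kap0_gt0 hw0 ts hrich
    (fun S j hj => height_ge0 hrho hJ hV bV hj Jp).
  have [z pz] := coding_surj hrho hJ hV bV Jp.
  have [N [eta eta0 hr]] := reachable_attractor hrho hJ hV bV z K Jxc xc_core.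
  rewrite -pz in hr; set q := fw _ xc in hr.
  have e4 : 0 <= eta / 4 by rewrite divr_ge0// ltW.
  have := hK _ _ _ _ _ eta0 hr (tracks_const q e4); apply/negP; rewrite -ltNge.
  apply: le_lt_trans St; apply: (@le_trans _ _ (hausdorff_dim (level q))).
    by apply: hausdorff_dim_sub; exact: drift_set_level.
  by apply: ereal_sup_ubound; exists q => //; exact: fw_attractor.
have [_ cJ _] := hJ.
have [delta [N [L [d0 hL]]]] := compact_sum_bound cJ nr.
move: sF; apply/negP; rewrite -leNgt; apply: hausdorff_dim_le => // t' st'.
apply: (@limsup_cover_null _ _ _ _ c J M hrho bJ _
  (fun w => `[< exists2 p, J p & near_average rho c x0 p delta w >]) s t' L N) => //.
  by rewrite s0.
move=> p [Jp cp] N'; have [y yp] := regular_surj hrho hJ hV bV Jp.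
rewrite yp in Jp cp *.
have [N1 hN1] := average_near hrho hJ hV bV Jx0 Jp cp d0.
exists (mkseq y (maxn N1 N')); split; first by rewrite size_mkseq leq_maxr.
  by apply/asboolP; exists (chi y) => //; rewrite hN1// leq_maxl.
by have [q Jq ->] := codingP hrho hJ hV bV y (maxn N1 N'); exists q.
Qed.

(** The hull seen through its supporting half-spaces, the form in which [reachable_convex] and
    [rich_drift_dim] use it. *)
Definition polar_hull : set 'rV[R]_d :=
  [set p | forall S j, lowest S j -> 0 <= height S j p].

Lemma polar_hull_compact : compact polar_hull.
Proof.
apply: bounded_closed_compact.
  exists M; split; first exact: num_real.
  move=> M' MM' p Ap; apply: (le_trans _ (ltW MM')).
  have M0 := bound_ge0 hrho hJ hV bV Jx0.
  apply: norm_le_coord => // i.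
  have dE (x : 'rV[R]_d) : dot (delta_mx ord0 i) x = x ord0 i.
    rewrite /dot (bigD1 i)//= mxE !eqxx mul1r big1 ?addr0// => k /negbTE ki.
    by rewrite mxE ki andbF mul0r.
  have dN (x : 'rV[R]_d) : dot (- delta_mx ord0 i) x = - x ord0 i.
    by rewrite dotC dotNr dotC dE.
  have cb j : `|fixpt j ord0 i| <= M.
    by apply: le_trans (coord_le_norm _ _) _; apply: bJ; exact: chiJ.
  (* The two opposite coordinate directions bound each coordinate by those of fixed points. *)
  have [j hj] := lowest_ex V hJ (delta_mx ord0 i).
  have [j' hj'] := lowest_ex V hJ (- delta_mx ord0 i).
  have := Ap _ _ hj; have := Ap _ _ hj'; rewrite /height !dE !dN => h1 h2.
  have := cb j; have := cb j'; rewrite !ler_norml => /andP[a1 a2] /andP[b1 b2].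
  by apply/andP; split; lra.
move=> p clp S j hj; apply/ler_addgt0Pr => e e0.
have S1 : 0 < norm1 S + 1 by rewrite ltr_wpDl// norm1_ge0.
have [q [Aq]] := clp _ (nbhsx_ballx p (e / (norm1 S + 1)) (divr_gt0 e0 S1)).
rewrite -ball_normE /= => hq.
have h1 := Aq S j hj; have h2 := dot_ge_norm1 S (p - q).
have h3 : norm1 S * `|p - q| <= e.
  move: hq; rewrite ltr_pdivlMr// => /ltW; apply: le_trans.
  by rewrite mulrC ler_wpM2l// lerDl.
by move: h1 h2; rewrite /height dotBr; lra.
Qed.

Lemma average_polar_hull w : w != [::] ->
  polar_hull ((size w)%:R^-1 *: word_sum rho c x0 w).
Proof.
move=> wn S j hj; have n0 : (0 : R) < (size w)%:R by rewrite ltr0n; case: w wn.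
rewrite /height dotZr subr_ge0 mulrC ler_pdivlMr//.
elim: w {wn n0} => [|i w IH]; first by rewrite mulr0 /dot big1// => i _;
  rewrite mxE mulr0.
rewrite word_sumS dotDr [size _]/= -natr1 mulrDr mulr1 addrC lerD//.
have := height_ge0 hrho hJ hV bV hj (fw_attractor hJ (i :: w) Jx0).
by rewrite /height subr_ge0.
Qed.

(** The average of every nonempty word lies in [polar_hull], so without a rich point there all words
    would have bounded sums and [J] would have dimension at most [s]. A rich point yields a level
    set of dimension at least [t]; maximality carries this to [p], and [fixed_average_dim_ge] to
    [F]. *)
Lemma fixed_average_full p : level p !=set0 ->
  (forall q, level q !=set0 -> (hausdorff_dim (level q) <= hausdorff_dim (level
    p))%E) ->
  J p -> hausdorff_dim F = hausdorff_dim J.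
Proof.
move=> _ pmax Jp; apply/eqP; rewrite eq_le; apply/andP; split.
  by apply: hausdorff_dim_sub => x [[Jx _] _].
rewrite leNgt; apply/negP => /ereal_between[|t [s [ts Ft sJ]]].
  exact: hausdorff_dim_ge0.
have s0 : 0 <= s by case/andP: ts => ? /ltW; exact: le_trans.
have [p' Ap' hrich] : exists2 p', polar_hull p' & rich rho c x0 p' s.
  apply: contrapT => nex.
  have nr p' : polar_hull p' -> ~ rich rho c x0 p' s.
    by move=> Ap' hr; apply: nex; exists p'.
  have [delta [N [L [d0 hL]]]] := compact_sum_bound polar_hull_compact nr.
  move: sJ; apply/negP; rewrite -leNgt; apply: hausdorff_dim_le => // t' st'.
  apply: (@limsup_cover_null _ _ _ _ c J M hrho bJ _ xpredT s t' L (maxn N 1)).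
  - by rewrite s0.
  - move=> x Jx N'; have [y ->] := coding_surj hrho hJ hV bV Jx.
    exists (mkseq y N'); split => //; first by rewrite size_mkseq.
    by have [q Jq ->] := codingP hrho hJ hV bV y N'; exists q.
  - move=> n; rewrite geq_max => /andP[Nn n0]; apply: le_trans (hL n Nn).
    rewrite [leRHS]big_mkcond; apply: ler_sum => w _.
    have wn : val w != [::] by rewrite -size_eq0 size_tuple -lt0n.
    rewrite asboolT//; exists ((size w)%:R^-1 *: word_sum rho c x0 w).
      exact: average_polar_hull.
    rewrite /near_average scalerA mulfV ?scale1r ?subrr ?normr0 ?mulr_ge0 ?(ltW d0)//.
    by rewrite pnatr_eq0 size_tuple -lt0n.
have [K hK] := rich_drift_dim hrho hJ hV bV Jx0 kap0_gt0 hw0 ts hrich Ap'.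
(* [p'] need not lie in [J], so the target is taken on the segment from [p'] to [xc]. *)
have [q [eta eta0 hr]] := reachable_convex K xc_core Ap'.
have e4 : 0 <= eta / 4 by rewrite divr_ge0// ltW.
have tq : (t%:E <= hausdorff_dim (level q))%E.
  apply: le_trans (hK _ _ _ _ _ eta0 hr (tracks_const q e4)) _.
  by apply: hausdorff_dim_sub; exact: drift_set_level.
have t0 : (0 < t%:E)%E by apply: le_lt_trans Ft; exact: hausdorff_dim_ge0.
(* Maximality is assumed against nonempty level sets only; an empty one has dimension 0, below
   [t]. *)
have Lq : level q !=set0.
  apply/set0P/negP => /eqP L0; move: tq; apply/negP; rewrite -ltNge L0.
  exact: le_lt_trans (hausdorff_dim_set0 _ _) t0.
have := le_trans tq (le_trans (pmax q Lq) (fixed_average_dim_ge Jp)).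
by rewrite leNgt Ft.
Qed.

End Spectrum.

Theorem theorem3p3 (R : realType) (d m : nat) (rho : 'I_m -> R)
    (c : 'I_m -> 'rV[R]_d) (J W : set 'rV[R]_d)
    (hd : (0 < d)%N)
    (hrho : forall j, 0 < rho j < 1)
    (hJ : is_attractor (ifs rho c) J)
    (hW : sosc (ifs rho c) J W)
    (hdim : has_affine_dim (convex_hull J) d) :
  let f := ifs rho c in
  let V := W `&` interior (convex_hull J) in
  let Jt := regular_attractor f V J in
  let gt := induced_map f V in
  let Phi := additive_potential gt id in
  let E := level_set Jt Phi in
  let D := fun alpha => hausdorff_dim (E alpha) in
  let L := [set alpha | E alpha !=set0] in
  let F := fixed_average_set Jt gt in
  [/\ J `<=` closure F,
      hausdorff_dim F = ereal_sup [set D alpha | alpha in J]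
    & forall alpha,
        L alpha -> (forall beta, L beta -> (D beta <= D alpha)%E) ->
        J alpha -> hausdorff_dim F = hausdorff_dim J].
Proof.
move=> f V Jt gt Phi E D L F.
have [[x0 Jx0] cJ JE] := hJ.
have [j0 _] : exists j0 : 'I_m, True by move: Jx0; rewrite JE => -[j _ _]; exists j.
have [C [_ hC]] := compact_bounded cJ.
have bJ p : J p -> `|p| <= C + 1 by apply: hC; rewrite ltrDl.
have bV p : V p -> `|p| <= C + 1.
  by move=> [_ /interior_subset]; exact: (convex_hull_bound bJ).
pose wc := enum 'I_m; pose xc := word_fixpt rho c wc.
have wcn : wc != [::] by apply/eqP => e; have := mem_enum 'I_m j0; rewrite -/wc e.
have Jxc : J xc := word_fixpt_attractor hrho hJ wcn.
have Hxc : interior (convex_hull J) xc := center_interior hrho hJ hdim j0.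
(* To see that [V] meets [J], the interior point [xc] is pushed into a small cylinder around a
   common point of [W] and [J]; its image lies in [J], in [W] and still in the interior of the
   hull. *)
have hV : sosc f J V.
  have [oW _ fW dW [v [Wv Jv]]] := hW.
  have [y hy] := attractor_code hJ Jv.
  have /nbhs_ballP[e /= e0 eW] : nbhs v W by exact: open_nbhs_nbhs.
  have r01 : 0 <= rmax rho < 1 by have /andP[/ltW -> ->] := rmax01 hrho.
  have [n hn] := expr_small (2 * (C + 1)) r01 e0.
  have [q Jq vq] := hy n.
  pose x := word_map f (mkseq y n) xc.
  have Wx : W x.
    apply: eW; rewrite -ball_normE /= vq.
    apply: le_lt_trans (fw_contract c hrho _ (bJ _ Jq) (bJ _ Jxc)) _.
    by rewrite size_mkseq; exact: hn.
  have Hx : interior (convex_hull J) x.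
    rewrite /x; elim: (mkseq y n) => [//|i w IH].
    exact: (interior_hull_ifs hrho hJ).
  split.
  - by apply: openI => //; exact: open_interior.
  - by exists x.
  - move=> j _ [p [Wp Hp] <-]; split; first by apply: fW; exists p.
    exact: (interior_hull_ifs hrho hJ).
  - move=> i j ij; rewrite -subset0 => p [[a [Wa _] <-] [b [Wb _] e']].
    by rewrite -(dW i j ij); split; [exists a|exists b].
  - by exists x; split => //; exact: fw_attractor.
have xcore := core_point_interior hrho hJ hV bV Hxc.
have [w0 [k0 [k00 hw0]]] := inner_word hrho hJ hV bV.
split.
- exact: (fixed_average_dense hrho hJ hV bV k00 hw0 Jx0 Jxc xcore).
- apply/eqP; rewrite eq_le; apply/andP; split.
    exact: (fixed_average_dim_le hrho hJ hV bV k00 hw0 Jx0 Jxc xcore).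
  apply: ge_ereal_sup => _ [p Jp <-].
  exact: (fixed_average_dim_ge hrho hJ hV bV k00 hw0 Jx0 Jxc xcore Jp).
- move=> p Lp pmax Jp.
  exact: (fixed_average_full hrho hJ hV bV k00 hw0 Jx0 Jxc xcore Lp pmax Jp).
Qed.
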